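(* Let $\alpha$ be an automorphism of a unital $C^*$-algebra $A$ with the property that for any finite subset $F$ of $A$ and for any integer $m\geq 2$ and $\varepsilon>0$ there are an $\varepsilon$-approximate stack $e_0,e_1,\dots,e_{m-1}$ for $\alpha$ and partial isometries $p,q$ in $A$ such that (1) $p^*p=1-\sum_{i=0}^{m-1}e_i$ and $pp^*<e_0$; (2) $q^*q=e_0$ and $qq^*=e_1$; (3) $\|[x,y]\|<\varepsilon$ for any $x\in F$ and $y\in\{p,q\}$. Then $\alpha$ has the Rohlin property.
   Context: $\mathbb{N}$ denotes the positive integers, $[x,y]=xy-yx$, and $1$ is the identity of $A$. For projections, $e<f$ means $e\le f$ and $e\ne f$ in the usual order on self-adjoint elements. An $\varepsilon$-approximate stack of height $m$ for $\alpha$ is a family of mutually orthogonal projections $e_0,\dots,e_{m-1}$ in $A$ with $\|\alpha(e_i)-e_{i+1}\|<\varepsilon$ for $i=0,\dots,m-2$ (no condition is imposed on $\alpha(e_{m-1})$). Rohlin property: an automorphism $\alpha$ of a unital $C^*$-algebra $A$ has the Rohlin property if for any $k\in\mathbb{N}$ there are $m\in\mathbb{N}$ and positive integers $k_0,\dots,k_{m-1}\geq k$ such that: for any finite subset $F$ of $A$ and any $\varepsilon>0$ there are projections $e_{i,j}$, $i=0,\dots,m-1$, $j=0,\dots,k_i-1$, in $A$ with (1) $\sum_{i=0}^{m-1}\sum_{j=0}^{k_i-1}e_{i,j}=1$; (2) $\|\alpha(e_{i,j})-e_{i,j+1}\|<\varepsilon$; (3) $\|[x,e_{i,j}]\|<\varepsilon$;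 for all $i=0,\dots,m-1$, $j=0,\dots,k_i-1$ and $x\in F$, where $e_{i,k_i}=e_{i,0}$. *)

(* Defs.v *)
From HB Require Import structures.
From mathcomp Require Import all_boot all_order all_algebra.
From mathcomp Require Import complex.
From mathcomp Require Import all_classical all_reals all_analysis.

Set Implicit Arguments.
Unset Strict Implicit.
Unset Printing Implicit Defensive.

Import Order.TTheory GRing.Theory Num.Theory.
Import numFieldNormedType.Exports.

Local Open Scope classical_set_scope.
Local Open Scope ring_scope.
Local Open Scope complex_scope.

(* Hierarchy-Builder cannot join the ring and norm hierarchies below numDomainType,
   so a unital complex C*-algebra is packed as a Banach space over R[i] with a
   product, unit and involution; the algType structure is derived below.
   The norm of a completeNormedModType over R[i] takes its values in R[i], where
   0 <= z forces z to be real. *)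
Record cstarAlgType (R : realType) := CStarAlgType {
  cstar_banach : completeNormedModType R[i];
  cstar_one : cstar_banach;
  cstar_mul : cstar_banach -> cstar_banach -> cstar_banach;
  cstar_star : cstar_banach -> cstar_banach;
  cstar_mulA : associative cstar_mul;
  cstar_mul1l : left_id cstar_one cstar_mul;
  cstar_mul1r : right_id cstar_one cstar_mul;
  cstar_mulDl : left_distributive cstar_mul +%R;
  cstar_mulDr : right_distributive cstar_mul +%R;
  cstar_scaleAl : forall (z : R[i]) x y,
    z *: cstar_mul x y = cstar_mul (z *: x) y;
  cstar_scaleAr : forall (z : R[i]) x y,
    z *: cstar_mul x y = cstar_mul x (z *: y);
  cstar_one_neq0 : cstar_one != 0;
  cstar_starK : involutive cstar_star;
  cstar_starD : {morph cstar_star : x y / x + y};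
  cstar_starZ : forall (z : R[i]) x,
    cstar_star (z *: x) = Num.conj z *: cstar_star x;
  cstar_starM : forall x y,
    cstar_star (cstar_mul x y) = cstar_mul (cstar_star y) (cstar_star x);
  cstar_normM : forall x y, `|cstar_mul x y| <= `|x| * `|y|;
  cstar_identity : forall x, `|cstar_mul (cstar_star x) x| = `|x| ^+ 2
}.

Definition cstar_sort (R : realType) (A : cstarAlgType R) : Type :=
  cstar_banach A.
Coercion cstar_sort : cstarAlgType >-> Sortclass.

HB.instance Definition _ (R : realType) (A : cstarAlgType R) :=
  CompleteNormedModule.on (cstar_sort A).
HB.instance Definition _ (R : realType) (A : cstarAlgType R) :=
  GRing.Zmodule_isNzRing.Build (cstar_sort A) (@cstar_mulA R A)
    (@cstar_mul1l R A) (@cstar_mul1r R A) (@cstar_mulDl R A) (@cstar_mulDr R A)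
    (@cstar_one_neq0 R A).
HB.instance Definition _ (R : realType) (A : cstarAlgType R) :=
  GRing.Lmodule_isLalgebra.Build R[i] (cstar_sort A) (@cstar_scaleAl R A).
HB.instance Definition _ (R : realType) (A : cstarAlgType R) :=
  GRing.Lalgebra_isAlgebra.Build R[i] (cstar_sort A) (@cstar_scaleAr R A).

Definition star (R : realType) (A : cstarAlgType R) (x : A) : A :=
  @cstar_star R A x.

Section CStar.
Context {R : realType} {A : cstarAlgType R}.
Implicit Types (x y a b e f p : A) (eps : R).

Definition self_adjoint a : Prop := star a = a.

Definition projection e : Prop := self_adjoint e /\ e * e = e.

Definition partial_isometry p : Prop := projection (star p * p).

Definition positive a : Prop := exists x, a = star x * x.

Definition cstar_le a b : Prop :=
  [/\ self_adjoint a, self_adjoint b & positive (b - a)].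

Definition cstar_lt a b : Prop := cstar_le a b /\ a <> b.

Definition commutator x y : A := x * y - y * x.

Definition star_automorphism (alpha : {lrmorphism A -> A}) : Prop :=
  bijective alpha /\ forall x, alpha (star x) = star (alpha x).

(* Only the values e 0, ..., e m.-1 are relevant. *)
Definition approximate_stack (alpha : A -> A) eps (m : nat) (e : nat -> A)
    : Prop :=
  [/\ forall i, (i < m)%N -> projection (e i),
      forall i j, (i < m)%N -> (j < m)%N -> i <> j -> e i * e j = 0
    & forall i, (i.+1 < m)%N -> `|alpha (e i) - e i.+1| < eps%:C].

(* The index j.+1 %% h i encodes the convention e_(i, h i) = e_(i, 0). *)
Definition rohlin_property (alpha : A -> A) : Prop :=
  forall k : nat, (0 < k)%N ->
  exists (m : nat) (h : nat -> nat),
  [/\ (0 < m)%N, forall i, (i < m)%N -> (k <= h i)%N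
    & forall (F : set A) (eps : R), finite_set F -> 0 < eps ->
      exists e : nat -> nat -> A,
      [/\ forall i j, (i < m)%N -> (j < h i)%N -> projection (e i j),
          \sum_(0 <= i < m) \sum_(0 <= j < h i) e i j = 1,
          forall i j, (i < m)%N -> (j < h i)%N ->
            `|alpha (e i j) - e i (j.+1 %% h i)%N| < eps%:C
        & forall i j x, (i < m)%N -> (j < h i)%N -> F x ->
            `|commutator x (e i j)| < eps%:C]].

End CStar.

(* Main.v *)
Require Import Defs.
From mathcomp Require Import all_boot all_order all_algebra.
From mathcomp Require Import complex.
From mathcomp Require Import all_classical all_reals all_analysis.
From HB Require Import structures.
From mathcomp Require Import zify ring lra.
Import Order.TTheory GRing.Theory Num.Theory.
Import numFieldNormedType.Exports.
Local Open Scope classical_set_scope.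
Local Open Scope ring_scope.
Local Open Scope complex_scope.

(** * From approximate stacks to the Rohlin property

The towers are not found for alpha itself.  One changes alpha by inner
automorphisms, Ad v o alpha with v a unitary close to 1, until the changed
automorphism permutes projections exactly in closed cycles with sum 1; since
the product of the unitaries used is close to 1, alpha permutes the same
projections approximately.

Straightening.  As alpha (e_i) is close to e_(i+1), the polar part of
sum_i e_(i+1) alpha (e_i) (completed by the complements) is a unitary v close
to 1 with v alpha (e_i) v^† = e_(i+1) exactly [intertwining_unitary].  From
here on write b for the changed automorphism.

Closing the stack.  The partial isometries T_i = b^(i-1)(q) ... b(q) q carry
e_0 to e_i.  Let J be large and let the stack have length L + J.  While i runs
from 0 to J, the vector cos(phi i) T_(L+i) + sin(phi i) T_i with
phi = pi / (2 J) turns from T_L to T_J.  Composing b with the rotation by the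
small angle phi in the planes spanned by T_i and T_(L+i) makes b follow these
vectors, so e_J, ..., e_L and J - 1 turning projections form an exact cycle of
length L [loop_path_step, loop_path_closed].  What is left over, Y = 1 - (sum
of the cycle), is now exactly invariant; it is e_infinity = p^† p together
with J projections equivalent to e_0.  This is what makes it possible to avoid
any cancellation argument: the equivalence class of the leftover need not be
compared with that of its image.

Absorbing the leftover.  Since Y is a sum of J + 1 pieces, each equivalent to
a subprojection of e_0, there is a partial isometry P from Y into every
(2 J)-th level of the cycle [embed].  The images b^i(P), i < 2 J, have source
Y and orthogonal ranges, and the same rotation trick closes them to a cycle
G_0, ..., G_(J-1) of partial isometries with source Y.  Removing their ranges
from the J residue classes of the long cycle leaves a cycle of J projections.
On the remaining part, Y and the G_j span a copy of the (J+1) x (J+1) matrices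
on which the automorphism acts as (cyclic shift of length J) + (a fixed
vector).  Its eigenvalues are exp (2 pi i m / J), m = 0, ..., J, which differ
by O(1/J) from the eigenvalues exp (2 pi i m / (J+1)) of the cyclic shift of
length J + 1.  A diagonal unitary close to 1 corrects them, and the discrete
Fourier transform of the eigenvectors is then a cycle of length J + 1
[absorb_tower].  Choosing J divisible by k and J + 1 divisible by k + 1, the
two cycles are cut into towers of heights k and k + 1 [exact_towers].

Centrality.  All of the construction is algebraic in p, q and b, with
coefficients that depend only on J.  It is therefore carried out once, in the
star-algebra of bounded sequences of elements of A that asymptotically commute
with the given finite set and its translates under powers of alpha^-1; the
towers then lie in that algebra, that is, they are asymptotically central.
The estimates on the unitaries are stated for every C*-seminorm, so that they
can be read off at each term of a sequence.

Facts about C*-algebras.  Three are needed and are derived from the C*-identity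
and completeness by the square root of 1 - r for |r| < 1: the polar part of an
element close to 1, the contractivity of star-endomorphisms (a self-adjoint
contraction is the mean of two unitaries), and the fact that p p^† <= e_0,
understood as e_0 - p p^† being of the form x^† x, implies e_0 p = p.  The last
one uses an argument of Kaplansky [npos_neg_gram]. *)

Set Implicit Arguments.
Unset Strict Implicit.
Unset Printing Implicit Defensive.

(** * Unimodular numbers and roots of unity *)

Section Cis.
Context {R : realType}.
Implicit Types x y : R.

Definition cis x : R[i] := cos x +i* sin x.

Lemma cisD x y : cis (x + y) = cis x * cis y.
Proof. by rewrite /cis cosD sinD; simpc; congr (_ +i* _); rewrite addrC. Qed.

Lemma cis0 : cis 0 = 1.
Proof. by rewrite /cis cos0 sin0. Qed.

Lemma cisMn x n : cis (x *+ n) = cis x ^+ n.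
Proof. by elim: n => [|n ih]; rewrite ?cis0 // mulrSr exprSr cisD ih. Qed.

Lemma conj_cis x : Num.conj (cis x) = cis (- x).
Proof. by rewrite /cis cosN sinN. Qed.

Lemma cisKN x : cis (- x) * cis x = 1.
Proof. by rewrite -cisD addNr cis0. Qed.

Lemma sinr_le x : `|sin x| <= `|x|.
Proof.
have h y : 0 <= y -> `|sin y| <= y.
  move=> y0.
  have dsin z : z \in `]0, y[ -> is_derive z 1 (@sin R) (cos z).
    by move=> _; exact: is_derive_sin.
  have csin : {within `[0, y], continuous (@sin R)}.
    by apply: continuous_subspaceT => z; exact: continuous_sin.
  have [c _] := MVT_segment y0 dsin csin.
  rewrite sin0 !subr0 => ->; rewrite normrM (ger0_norm y0) -[leRHS]mul1r.
  by rewrite ler_wpM2r// cos_max.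
have [x0|/ltW x0] := leP 0 x; first by rewrite (ger0_norm x0) h.
by rewrite (ler0_norm x0) -normrN -sinN h// oppr_ge0.
Qed.

Lemma cos_half x : cos x = 1 - 2 * sin (x / 2) ^+ 2.
Proof.
have := cosD (x / 2) (x / 2); rewrite -splitr => ->.
have := cos2Dsin2 (x / 2); lra.
Qed.

Lemma sqr_normc (z : R[i]) :
  Normc.normc z ^+ 2 = complex.Re z ^+ 2 + complex.Im z ^+ 2.
Proof. by case: z => a b; rewrite /Normc.normc sqr_sqrtr// addr_ge0 ?sqr_ge0. Qed.

(** The chord is at most the arc: |cis x - 1| = 2 |sin (x / 2)|. The order in
    x matters, since later a sum of n such squares with x of order 1 / n must
    be small. *)
Lemma sqr_normc_cisB1 x : Normc.normc (cis x - 1) ^+ 2 <= x ^+ 2.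
Proof.
rewrite sqr_normc /=.
have -> : (cos x - 1) ^+ 2 + (sin x - 0) ^+ 2 = 4 * sin (x / 2) ^+ 2.
  by have := cos_half x; have := cos2Dsin2 x; lra.
have : sin (x / 2) ^+ 2 <= (x / 2) ^+ 2.
  rewrite -real_normK ?num_real// -[leRHS]real_normK ?num_real//.
  by rewrite ler_sqr ?nnegrE// sinr_le.
lra.
Qed.

Lemma cis_neq1 x : 0 < x < pi *+ 2 -> cis x != 1.
Proof.
move=> /andP[x0 x2]; apply/eqP => -[+ _].
rewrite cos_half => h.
have : 0 < sin (x / 2).
  by apply: sin_gt0_pi; rewrite divr_gt0//= ltr_pdivrMr// mulr_natr.
have /eqP : sin (x / 2) ^+ 2 = 0 by lra.
by rewrite sqrf_eq0 => /eqP ->; rewrite ltxx.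
Qed.

Lemma cis_2pi : cis (pi *+ 2) = 1.
Proof. by rewrite /cis cos2pi sin2pi. Qed.

(** Both signs of the angle are allowed because the Fourier transform is used
    in the two directions. *)
Lemma sum_cis (n d : nat) (t : R) : (0 < d < n)%N ->
  t = pi *+ 2 / n%:R \/ t = - (pi *+ 2 / n%:R) ->
  \sum_(j < n) cis (t *+ d *+ j) = 0.
Proof.
move=> /andP[d0 dn] ht.
have n0 : (0 < n)%N by exact: leq_ltn_trans dn.
have nR : (n%:R : R) != 0 by rewrite pnatr_eq0 -lt0n.
pose w : R := pi *+ 2 / n%:R; rewrite -/w in ht.
have w1 : cis (w *+ d) != 1.
  have pi2 : 0 < (pi : R) *+ 2 by rewrite pmulrn_lgt0 ?pi_gt0.
  apply: cis_neq1; apply/andP; split.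
    by rewrite pmulrn_lgt0// divr_gt0 ?ltr0n.
  rewrite -mulr_natr mulrAC ltr_pdivrMr ?ltr0n//.
  by rewrite ltr_pM2l ?ltr_nat.
have cisN1 x : cis x = 1 -> cis (- x) = 1.
  by move=> h; have := cisKN x; rewrite h mulr1.
have z1 : cis (t *+ d) != 1.
  case: ht => ->; first exact: w1.
  apply: contraNneq w1 => /cisN1; rewrite mulNrn opprK => ->.
  exact: eqxx.
have zn : cis (t *+ d) ^+ n = 1.
  have wn : w *+ d *+ n = (pi *+ 2) *+ d.
    rewrite -(mulr_natr (w *+ d)) -(mulr_natr w) -(mulr_natr (pi *+ 2) d) /w.
    by rewrite -mulrA [d%:R * _]mulrC mulrA divfK.
  have wn1 : cis (w *+ d *+ n) = 1 by rewrite wn cisMn cis_2pi expr1n.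
  rewrite -cisMn; case: ht => ->; first exact: wn1.
  by rewrite !mulNrn; exact: cisN1.
under eq_bigr do rewrite cisMn.
have : (cis (t *+ d) - 1) * \sum_(j < n) cis (t *+ d) ^+ j = 0.
  by rewrite -subrX1 zn subrr.
by move/eqP; rewrite mulf_eq0 subr_eq0 (negbTE z1) /= => /eqP.
Qed.

End Cis.

(** * Star-algebras, C*-seminorms and unitaries diagonal in a family of partial isometries *)

(** The algebraic part of the argument is carried out in this generality
    because it is applied to an algebra of sequences, on which no single norm
    is at hand. *)
Record starAlg (R : realType) := StarAlg {
  starAlg_alg :> algType R[i];
  dag : starAlg_alg -> starAlg_alg;
  dagK : involutive dag;
  dagD : {morph dag : x y / x + y};
  dagZ : forall (c : R[i]) x, dag (c *: x) = Num.conj c *: dag x;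
  dagM : forall x y, dag (x * y) = dag y * dag x }.

Notation "x ^†" := (dag x) (at level 2, format "x ^†") : ring_scope.

Record starEndo (R : realType) (S : starAlg R) := StarEndo {
  endo_fun :> S -> S;
  endoD : {morph endo_fun : x y / x + y};
  endoM : {morph endo_fun : x y / x * y};
  endoZ : forall (c : R[i]) x, endo_fun (c *: x) = c *: endo_fun x;
  endo1 : endo_fun 1 = 1;
  endo_dag : forall x, endo_fun x^† = (endo_fun x)^† }.

Section StarAlgebra.
Context {R : realType} {S : starAlg R}.
Implicit Types (x y z s E u v : S) (b : starEndo S).

Lemma dag0 : (0 : S)^† = 0.
Proof. by have := dagZ 0 (0 : S); rewrite !scale0r rmorph0 scale0r. Qed.

Lemma dagN x : (- x)^† = - x^†.
Proof. by apply: (addrI x^†); rewrite -dagD !subrr dag0. Qed.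

Lemma dagB x y : (x - y)^† = x^† - y^†.
Proof. by rewrite dagD dagN. Qed.

Lemma dag1 : (1 : S)^† = 1.
Proof. by rewrite -[LHS]mulr1 -{2}[1]dagK -dagM mulr1 dagK. Qed.

Lemma dag_sum I r (P : pred I) (F : I -> S) :
  (\sum_(i <- r | P i) F i)^† = \sum_(i <- r | P i) (F i)^†.
Proof. exact: (big_morph (@dag R S) (@dagD R S) dag0). Qed.

Lemma dagZr (a : R) x : (a%:C *: x)^† = a%:C *: x^†.
Proof. by rewrite dagZ; congr (_ *: _); rewrite /Num.conj /= oppr0. Qed.

Lemma endo0 b : b 0 = 0.
Proof. by have := endoZ b 0 0; rewrite !scale0r. Qed.

Lemma endoN b x : b (- x) = - b x.
Proof. by apply: (addrI (b x)); rewrite -endoD !subrr endo0. Qed.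

Lemma endoB b x y : b (x - y) = b x - b y.
Proof. by rewrite endoD endoN. Qed.

Lemma endo_sum b I r (P : pred I) (F : I -> S) :
  b (\sum_(i <- r | P i) F i) = \sum_(i <- r | P i) b (F i).
Proof. exact: (big_morph b (endoD b) (endo0 b)). Qed.

Definition selfadj x := x^† = x.

Definition isproj x := selfadj x /\ x * x = x.

Definition isunitary u := u^† * u = 1 /\ u * u^† = 1.

Lemma unitaryM u v : isunitary u -> isunitary v -> isunitary (u * v).
Proof.
move=> [u1 u2] [v1 v2]; split; rewrite dagM mulrA.
  by rewrite -(mulrA v^†) u1 mulr1.
by rewrite -(mulrA u) v2 mulr1.
Qed.

(** The proof that v is unitary is an argument: it is what makes the perturbed
    map multiplicative. *)
Program Definition Ad v (hv : isunitary v) b : starEndo S :=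
  @StarEndo R S (fun x => v * b x * v^†) _ _ _ _ _.
Next Obligation. by move=> v _ b x y; rewrite endoD mulrDr mulrDl. Qed.
Next Obligation.
move=> v [hv _] b x y; rewrite endoM !mulrA; congr (_ * _ * _).
by rewrite -(mulrA _ v^†) hv mulr1.
Qed.
Next Obligation. by move=> v _ b c x; rewrite /= endoZ -scalerAr -scalerAl. Qed.
Next Obligation. by move=> v [_ hv] b; rewrite endo1 mulr1. Qed.
Next Obligation. by move=> v _ b x; rewrite /= endo_dag !dagM dagK mulrA. Qed.

(** Closeness to 1 of a unitary of a star-algebra is expressed by a bound
    valid for all nu of this kind; evaluation at the n-th term of a sequence,
    followed by the norm of A, is one. *)
Record cstarSeminorm (nu : S -> R) : Prop := CstarSeminorm {
  csn_ge0 : forall x, 0 <= nu x;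
  csnD : forall x y, nu (x + y) <= nu x + nu y;
  csnM : forall x y, nu (x * y) <= nu x * nu y;
  csnZ : forall c x, nu (c *: x) = Normc.normc c * nu x;
  csnC : forall x, nu (x^† * x) = nu x ^+ 2 }.

Lemma csn_sum nu (hnu : cstarSeminorm nu) I r (P : pred I) (F : I -> S) :
  nu (\sum_(i <- r | P i) F i) <= \sum_(i <- r | P i) nu (F i).
Proof.
elim/big_ind2 : _ => // [|x a y c h1 h2].
  by have := csnZ hnu 0 0; rewrite scale0r Normc.normc0 mul0r => ->.
by apply: le_trans (csnD hnu _ _) _; rewrite lerD.
Qed.

Lemma csn_proj nu x : cstarSeminorm nu -> isproj x -> nu x <= 1.
Proof.
move=> hnu [h1 h2]; have := csnC hnu x; rewrite h1 h2 => h.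
have := csn_ge0 hnu x; rewrite le_eqVlt => /predU1P[<-//|x0].
by rewrite -(ler_pM2r x0) mul1r -expr2 -h.
Qed.

Lemma proj1 : isproj (1 : S).
Proof. by split; [exact: dag1|rewrite mulr1]. Qed.

Lemma csn_unitary nu u : cstarSeminorm nu -> isunitary u -> nu u <= 1.
Proof.
move=> hnu [hu _]; have := csnC hnu u; rewrite hu => h.
rewrite -(@ler_pXn2r _ 2) ?nnegrE ?csn_ge0//.
by rewrite -h expr1n csn_proj//; exact: proj1.
Qed.

(** An orthogonal family of partial isometries with common source s; up to the
    corner at s, a system of basis vectors. The second clause is not automatic
    in a star-algebra without a norm. *)
Definition isofam (I : finType) s (V : I -> S) :=
  (forall a c, (V a)^† * V c = if a == c then s else 0) /\
  (forall a, V a * s = V a).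

Section Phase.
Context (I : finType) (s : S) (V : I -> S).
Hypothesis hV : isofam s V.

Lemma isofam_proj a : isproj (V a * (V a)^†).
Proof.
case: hV => h1 h2; split; first by rewrite /selfadj dagM dagK.
by rewrite mulrA -(mulrA (V a)) h1 eqxx h2.
Qed.

Lemma isofam_sum_mul (c d : I -> R[i]) :
  (\sum_a c a *: (V a * (V a)^†)) * (\sum_a d a *: (V a * (V a)^†)) =
  \sum_a (c a * d a) *: (V a * (V a)^†).
Proof.
case: hV => h1 h2.
rewrite mulr_suml; apply: eq_bigr => a _; rewrite mulr_sumr (bigD1 a)//=.
rewrite big1 ?addr0 => [|i ia].
  by rewrite -scalerAl -scalerAr scalerA (isofam_proj a).2.
rewrite -scalerAl -scalerAr mulrA -(mulrA (V a)) h1 eq_sym (negbTE ia).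
by rewrite mulr0 mul0r !scaler0.
Qed.

(** The unitary with eigenvalue mu a on the range of V a and 1 on the
    complement. Both the rotations and the spectral correction below are of
    this form. *)
Definition phase_op (mu : I -> R[i]) : S :=
  1 + \sum_a (mu a - 1) *: (V a * (V a)^†).

Lemma phase_op_vec mu a : phase_op mu * V a = mu a *: V a.
Proof.
case: hV => h1 h2.
rewrite mulrDl mul1r mulr_suml (bigD1 a)//= big1 => [|i ia].
  by rewrite addr0 -scalerAl -mulrA h1 eqxx h2 -{1}[V a]scale1r -scalerDl addrC subrK.
by rewrite -scalerAl -mulrA h1 (negbTE ia) mulr0 scaler0.
Qed.

Lemma phase_op_orth mu x : (forall a, (V a)^† * x = 0) -> phase_op mu * x = x.
Proof.
move=> hx; rewrite mulrDl mul1r mulr_suml big1 ?addr0// => a _.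
by rewrite -scalerAl -mulrA hx mulr0 scaler0.
Qed.

Lemma phase_op_comm mu E :
  (forall a, E * (V a * (V a)^†) = V a * (V a)^† * E) ->
  phase_op mu * E = E * phase_op mu.
Proof.
move=> hE; rewrite mulrDl mulrDr mul1r mulr1; congr (_ + _).
by rewrite mulr_suml mulr_sumr; apply: eq_bigr => a _; rewrite -scalerAl -scalerAr hE.
Qed.

Lemma phase_op_dag mu : (phase_op mu)^† = phase_op (fun a => Num.conj (mu a)).
Proof.
rewrite dagD dag1 dag_sum; congr (_ + _); apply: eq_bigr => a _.
by rewrite dagZ rmorphB rmorph1 dagM dagK.
Qed.

Lemma phase_opM mu mu' :
  phase_op mu * phase_op mu' = phase_op (fun a => mu a * mu' a).
Proof.
rewrite mulrDl mul1r mulrDr mulr1 isofam_sum_mul -addrA -!big_split /=.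
rewrite /phase_op; congr (_ + _); apply: eq_bigr => a _.
by rewrite -!scalerDl; congr (_ *: _); ring.
Qed.

Lemma phase_op_unitary mu :
  (forall a, mu a * Num.conj (mu a) = 1) -> isunitary (phase_op mu).
Proof.
move=> hmu; split; rewrite phase_op_dag phase_opM /phase_op big1 ?addr0// => a _.
  by rewrite mulrC hmu subrr scale0r.
by rewrite hmu subrr scale0r.
Qed.

(** The square of phase_op mu - 1 is a combination of the projections V a V
    a^†; bounding it by the sum of the coefficients, rather than by their
    maximum, loses nothing that matters and needs no spectral theory. *)
Lemma phase_op_near mu nu : cstarSeminorm nu ->
  nu (phase_op mu - 1) ^+ 2 <= \sum_a Normc.normc (mu a - 1) ^+ 2.
Proof.
move=> hnu; rewrite -csnC// addrC addKr.
have -> : (\sum_a (mu a - 1) *: (V a * (V a)^†))^† =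
    \sum_a Num.conj (mu a - 1) *: (V a * (V a)^†).
  by rewrite dag_sum; apply: eq_bigr => a _; rewrite dagZ dagM dagK.
rewrite isofam_sum_mul; apply: le_trans (csn_sum hnu _ _ _) _.
apply: ler_sum => a _; rewrite csnZ// Normc.normcM.
have -> : Normc.normc (Num.conj (mu a - 1)) = Normc.normc (mu a - 1).
  by case: (mu a - 1) => x y; rewrite /Num.conj /Normc.normc /= sqrrN.
rewrite -expr2 -[leRHS]mulr1 ler_wpM2l ?sqr_ge0//.
by apply: csn_proj => //; exact: isofam_proj.
Qed.

End Phase.
End StarAlgebra.

(** * Chains of partial isometries and the rotation that crosses them *)

Lemma sum_nat_add (V : nmodType) (m n : nat) (F : nat -> V) :
  \sum_(0 <= i < m + n) F i =
  \sum_(0 <= i < m) F i + \sum_(0 <= i < n) F (m + i)%N.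
Proof.
rewrite (@big_cat_nat _ _ _ m)//= ?leq_addr//; congr (_ + _).
by rewrite -{1}[m]addn0 addnC big_addn addKn; apply: eq_bigr => i _; rewrite addnC.
Qed.

Lemma sum_nat_single (V : nmodType) n i (F : nat -> V) : (i < n)%N ->
  (forall j, (j < n)%N -> j != i -> F j = 0) -> \sum_(0 <= j < n) F j = F i.
Proof.
move=> hi hF; rewrite big_mkord (bigD1 (Ordinal hi))//= big1 ?addr0// => j ji.
exact: hF.
Qed.

Section Chain.
Context {R : realType} {S : starAlg R}.
Implicit Types (x y z s q E u v : S) (b : starEndo S).

(** A sequence of partial isometries from s that b moves one step ahead, up to
    the fixed partial isometry q from s to b s. It is used for s = e_0, with q
    the given equivalence of e_0 and e_1, and for an invariant s with q = s.
    *)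
Record chain b s q (T : nat -> S) (N : nat) : Prop := Chain {
  chain_s : isproj s;
  chain_qq : q^† * q = s;
  chain_qqd : q * q^† = b s;
  chain_next : forall i, T i.+1 = b (T i) * q;
  chain_src : forall i, T i * s = T i;
  chain_orth : forall i j, (i < N)%N -> (j < N)%N ->
    (T i)^† * T j = if i == j then s else 0 }.

Context (b : starEndo S) (s q : S) (T : nat -> S) (M K : nat).
Local Notation L := (M + K)%N.
Hypothesis hT : chain b s q T (L + K).

Lemma chain_endo i : b (T i) = T i.+1 * q^†.
Proof.
by rewrite (chain_next hT) -mulrA (chain_qqd hT) -endoM (chain_src hT).
Qed.

(** Applying b to the relations between T 0, ..., T (L + K - 1) gives those
    between T 1, ..., T (L + K): the chain may be prolonged by one term, which
    is orthogonal to all but possibly the first one. *)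
Lemma chain_orthS i j : (i < L + K)%N -> (j < L + K)%N ->
  (T i.+1)^† * T j.+1 = if i == j then s else 0.
Proof.
move=> hi hj; rewrite !(chain_next hT) dagM -endo_dag mulrA -(mulrA q^†) -endoM.
rewrite (chain_orth hT)//; case: eqP => _; last by rewrite endo0 mulr0 mul0r.
rewrite -(chain_qqd hT) !mulrA (chain_qq hT) -mulrA (chain_qq hT).
exact: (chain_s hT).2.
Qed.

Lemma comb_dagM (a1 b1 a2 b2 : R) i j k l :
  (a1%:C *: T i + b1%:C *: T j)^† * (a2%:C *: T k + b2%:C *: T l) =
  (a1 * a2)%:C *: ((T i)^† * T k) + (a1 * b2)%:C *: ((T i)^† * T l) +
  ((b1 * a2)%:C *: ((T j)^† * T k) + (b1 * b2)%:C *: ((T j)^† * T l)).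
Proof.
rewrite dagD !dagZr mulrDl !mulrDr -!scalerAl -!scalerAr !scalerA -!rmorphM.
by [].
Qed.

(** K rotations by this angle make a quarter turn. *)
Definition rot_angle : R := pi / 2 / K%:R.
Local Notation phi := rot_angle.

(** The eigenvectors of the rotations in the planes spanned by T i and T (L +
    i), 0 < i <= K. *)
Definition cross_vec (a : 'I_K * bool) : S :=
  ((Num.sqrt 2)^-1)%:C *: (T (L + a.1.+1) +
     (if a.2 then 'i else - 'i) *: T a.1.+1).

Definition cross_phase (a : 'I_K * bool) : R[i] :=
  cis (if a.2 then - phi else phi).

Definition cross_op : S := phase_op cross_vec cross_phase.

Lemma sqrt2V : ((Num.sqrt 2)^-1 * (Num.sqrt 2)^-1 : R) = 2^-1.
Proof. by rewrite -invfM -expr2 sqr_sqrtr. Qed.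

Lemma chain_orth0 i j : (0 < i <= L + K)%N -> (0 < j <= L + K)%N ->
  (T i)^† * T j = if i == j then s else 0.
Proof.
by case: i => // i; case: j => // j /andP[_ hi] /andP[_ hj]; rewrite chain_orthS.
Qed.

Lemma cross_vec_isofam : isofam s cross_vec.
Proof.
split=> [[i c] [j d]|[i c]]; last first.
  by rewrite /cross_vec -scalerAl mulrDl -scalerAl !(chain_src hT).
rewrite /cross_vec /= dagZr dagD dagZ -scalerAl -scalerAr scalerA -rmorphM /= sqrt2V.
have hi := ltn_ord i; have hj := ltn_ord j.
rewrite mulrDl !mulrDr -!scalerAl -!scalerAr scalerA.
rewrite !chain_orth0; try by apply/andP; split; rewrite ?addnS//; lia.
rewrite eqn_add2l eqSS.
have -> : (L + i.+1 == j.+1)%N = false by lia.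
have -> : (i.+1 == L + j.+1)%N = false by lia.
rewrite !scaler0 addr0 add0r xpair_eqE -val_eqE /=.
case: (val i == val j) => /=; last by rewrite scaler0 addr0 scaler0.
rewrite -{1}[s]scale1r -scalerDl scalerA.
case: c; case: d; rewrite /= /Num.conj /=; simpc.
- by rewrite -[RHS]scale1r; congr (_ *: _); congr (_ +i* _); lra.
- exact: scale0r.
- exact: scale0r.
- by rewrite -[RHS]scale1r; congr (_ *: _); congr (_ +i* _); lra.
Qed.

Lemma cross_unitary : isunitary cross_op.
Proof.
apply: (phase_op_unitary cross_vec_isofam) => a.
by rewrite conj_cis mulrC cisKN.
Qed.

(** The bound is of order 1 / K. *)
Lemma cross_near nu : cstarSeminorm nu ->
  nu (cross_op - 1) ^+ 2 <= phi ^+ 2 *+ (2 * K).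
Proof.
move=> hnu.
apply: le_trans (phase_op_near cross_vec_isofam cross_phase hnu) _.
have -> : phi ^+ 2 *+ (2 * K) = \sum_(a : 'I_K * bool) phi ^+ 2.
  by rewrite sumr_const card_prod card_ord card_bool mulnC.
apply: ler_sum => -[i c] _; apply: le_trans (sqr_normc_cisB1 _) _.
by case: c; rewrite ?sqrrN.
Qed.

Lemma cross_op_fix x :
  (forall i, (0 < i <= K)%N -> (T i)^† * x = 0 /\ (T (L + i))^† * x = 0) ->
  cross_op * x = x.
Proof.
move=> hx; apply: phase_op_orth => -[i c].
have [|h1 h2] := hx i.+1; first by have := ltn_ord i; lia.
rewrite /cross_vec /= dagZr dagD dagZ -scalerAl mulrDl -scalerAl h1 h2.
by rewrite scaler0 addr0 scaler0.
Qed.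

Lemma cross_op_comm E : selfadj E ->
  (forall i, (0 < i <= K)%N ->
     (E * T i = T i /\ E * T (L + i) = T (L + i)) \/
     (E * T i = 0 /\ E * T (L + i) = 0)) ->
  cross_op * E = E * cross_op.
Proof.
move=> sE hE; apply: phase_op_comm => -[i c].
have [|[h1 h2]|[h1 h2]] := hE i.+1; first by have := ltn_ord i; lia.
  have h : E * cross_vec (i, c) = cross_vec (i, c).
    by rewrite /cross_vec /= -scalerAr mulrDr -scalerAr h1 h2.
  by rewrite mulrA h -mulrA -sE -dagM h.
have h : E * cross_vec (i, c) = 0.
  by rewrite /cross_vec /= -scalerAr mulrDr -scalerAr h1 h2 scaler0 addr0 scaler0.
by rewrite mulrA h -mulrA -sE -dagM h dag0 mul0r mulr0.
Qed.

Lemma cross_op_rot (i : 'I_K) (a c : R) :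
  cross_op * (a%:C *: T (L + i.+1) + c%:C *: T i.+1) =
  (a * cos phi - c * sin phi)%:C *: T (L + i.+1) +
  (a * sin phi + c * cos phi)%:C *: T i.+1.
Proof.
pose z d : R[i] := ((Num.sqrt 2)^-1)%:C * (a +i* (if d then - c else c)).
have z2 d : ((Num.sqrt 2)^-1)%:C * z d = Complex (a / 2) ((if d then - c else c) / 2).
  rewrite /z mulrA -rmorphM /= sqrt2V; simpc.
  by congr (_ +i* _); case: d => /=; lra.
have e (f : bool -> R[i]) : \sum_(d : bool) f d *: cross_vec (i, d) =
    (((Num.sqrt 2)^-1)%:C * f true + ((Num.sqrt 2)^-1)%:C * f false)
      *: T (L + i.+1) +
    (((Num.sqrt 2)^-1)%:C * f true * 'i - ((Num.sqrt 2)^-1)%:C * f false * 'i)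
      *: T i.+1.
  rewrite big_bool /cross_vec /= !scalerDr !scalerA addrACA.
  congr (_ + _); rewrite -scalerDl; congr (_ *: _).
    by rewrite !(mulrC _%:C).
  by rewrite !mulrN !mulrA !(mulrC _%:C).
have -> : a%:C *: T (L + i.+1) + c%:C *: T i.+1 =
    \sum_(d : bool) z d *: cross_vec (i, d).
  rewrite e !z2.
  by congr (_ *: _ + _ *: _); simpc; congr (_ +i* _); lra.
have -> : cross_op * (\sum_(d : bool) z d *: cross_vec (i, d)) =
    \sum_(d : bool) (cross_phase (i, d) * z d) *: cross_vec (i, d).
  rewrite mulr_sumr; apply: eq_bigr => d _.
  by rewrite -scalerAr (phase_op_vec cross_vec_isofam) scalerA mulrC.
rewrite e ![_%:C * (_ * z _)]mulrCA !z2 /cross_phase /cis /= cosN sinN.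
by congr (_ *: _ + _ *: _); simpc; congr (_ +i* _); lra.
Qed.

(** The path that turns from T L at i = 0 to T K at i = K. *)
Definition down_path i : S :=
  (cos (phi *+ i))%:C *: T (L + i) + (sin (phi *+ i))%:C *: T i.

(** The orthogonal companion of down_path in the same plane. *)
Definition up_path i : S :=
  (cos (phi *+ i))%:C *: T i + (- sin (phi *+ i))%:C *: T (L + i).

(** The automorphism moves both terms one step ahead and the rotation adds
    rot_angle to the angle, so the perturbed automorphism follows the path
    exactly. *)
Lemma down_path_step i : (i < K)%N ->
  cross_op * b (down_path i) = down_path i.+1 * q^†.
Proof.
move=> hi; rewrite endoD !endoZ !chain_endo !scalerAl -mulrDl mulrA -addnS.
rewrite (cross_op_rot (Ordinal hi)) /down_path /= mulrSr cosD sinD.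
by congr (_ * _); congr (_%:C *: _ + _%:C *: _); ring.
Qed.

End Chain.

(** * The closed path obtained by crossing a chain with itself *)

Section Closing.
Context {R : realType} {S : starAlg R} (b : starEndo S) (s q : S).
Context (T : nat -> S) (M K : nat).
Local Notation L := (M + K)%N.
Local Notation phi := (rot_angle K : R).
Hypothesis hT : chain b s q T (L + K).

Definition loop_path a : S :=
  if (a <= M)%N then T (K + a)%N else down_path T M K (a - M).

Lemma loop_path_low a : (a <= M)%N -> loop_path a = T (K + a)%N.
Proof. by rewrite /loop_path => ->. Qed.

Lemma loop_path_high i : loop_path (M + i) = down_path T M K i.
Proof.
rewrite /loop_path addKn; case: i => [|i]; last by rewrite addnS ltnNge leq_addr.
rewrite addn0 leqnn /down_path mulr0n cos0 sin0 scale1r scale0r addr0.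
by rewrite addn0 addnC.
Qed.

Lemma loop_path_closed (K0 : (0 < K)%N) : loop_path L = loop_path 0.
Proof.
rewrite loop_path_high loop_path_low// addn0 /down_path.
have -> : phi *+ K = pi / 2.
  by rewrite /rot_angle -[LHS]mulr_natr divfK// pnatr_eq0 -lt0n.
by rewrite cos_pihalf sin_pihalf scale1r scale0r add0r.
Qed.

(** The levels strictly between K and L are untouched by the rotation; the
    remaining ones are those of down_path. *)
Lemma loop_path_step a : (a < L)%N ->
  cross_op T M K * b (loop_path a) = loop_path a.+1 * q^†.
Proof.
move=> aL; have [aM|Ma] := ltnP a M.
  rewrite !loop_path_low// 1?ltnW// (chain_endo hT) mulrA addnS; congr (_ * _).
  apply: cross_op_fix => i hi.
  by split; rewrite (chain_orth0 hT); try lia; case: eqP => //; lia.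
rewrite -(subnKC Ma) -addnS !loop_path_high; apply: (down_path_step hT).
by lia.
Qed.

Lemma comb_src (x y : S) (c d : R) : x * s = x -> y * s = y ->
  (c%:C *: x + d%:C *: y) * s = c%:C *: x + d%:C *: y.
Proof. by move=> hx hy; rewrite mulrDl -!scalerAl hx hy. Qed.

Lemma loop_path_src a : loop_path a * s = loop_path a.
Proof.
rewrite /loop_path; case: ifP => _; first exact: (chain_src hT).
by apply: comb_src; exact: (chain_src hT).
Qed.

Lemma up_path_src i : up_path T M K i * s = up_path T M K i.
Proof. by apply: comb_src; exact: (chain_src hT). Qed.

Lemma down_pathM i j : (i < K)%N -> (j < K)%N ->
  (down_path T M K i)^† * down_path T M K j = if i == j then s else 0.
Proof.
move=> hi hj; rewrite (comb_dagM T).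
rewrite !(chain_orth hT); try lia.
have -> : (L + i == j)%N = false by lia.
have -> : (i == L + j)%N = false by lia.
rewrite eqn_add2l; case: eqP => [->|_]; last by rewrite !scaler0 !addr0.
rewrite !scaler0 addr0 add0r -scalerDl -rmorphD /= -!expr2 cos2Dsin2.
exact: scale1r.
Qed.

Lemma up_down_pathM i j : (i < K)%N -> (j < K)%N ->
  (up_path T M K i)^† * down_path T M K j = 0.
Proof.
move=> hi hj; rewrite (comb_dagM T).
rewrite !(chain_orth hT); try lia.
have -> : (L + i == j)%N = false by lia.
have -> : (i == L + j)%N = false by lia.
rewrite eqn_add2l; case: eqP => [->|_]; last by rewrite !scaler0 !addr0.
rewrite !scaler0 addr0 add0r -scalerDl -rmorphD /=.
have -> : cos (phi *+ j) * sin (phi *+ j) + - sin (phi *+ j) * cos (phi *+ j) = 0.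
  by ring.
exact: scale0r.
Qed.

Lemma comb_chainM (c d : R) i j k : (i < L + K)%N -> (j < L + K)%N ->
  (k < L + K)%N -> i != k -> j != k ->
  (c%:C *: T i + d%:C *: T j)^† * T k = 0.
Proof.
move=> hi hj hk ik jk; rewrite dagD !dagZr mulrDl -!scalerAl.
by rewrite !(chain_orth hT)// (negbTE ik) (negbTE jk) !scaler0 addr0.
Qed.

Lemma loop_pathM a c : (a < L)%N -> (c < L)%N ->
  (loop_path a)^† * loop_path c = if a == c then s else 0.
Proof.
have h a' j : (a' < M)%N -> (j < K)%N ->
    (down_path T M K j)^† * T (K + a')%N = 0.
  by move=> ha hj; apply: comb_chainM; lia.
move=> ha hc; have [aM|Ma] := ltnP a M; have [cM|Mc] := ltnP c M.
- rewrite !loop_path_low 1?ltnW// (chain_orth hT) ?eqn_add2l//; lia.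
- rewrite loop_path_low 1?ltnW// -(subnKC Mc) loop_path_high.
  rewrite -[LHS]dagK dagM dagK h ?dag0//; last by lia.
  by case: eqP => //; lia.
- rewrite [loop_path c]loop_path_low 1?ltnW// -(subnKC Ma) loop_path_high.
  rewrite h//; last by lia.
  by case: eqP => //; lia.
rewrite -{1}(subnKC Ma) -{1}(subnKC Mc) !loop_path_high down_pathM; try lia.
by congr (if _ then _ else _); lia.
Qed.

Lemma up_loop_pathM i c : (i < K)%N -> (c < L)%N ->
  (up_path T M K i)^† * loop_path c = 0.
Proof.
move=> hi hc; have [cM|Mc] := ltnP c M.
  by rewrite loop_path_low 1?ltnW//; apply: comb_chainM; lia.
by rewrite -(subnKC Mc) loop_path_high up_down_pathM//; lia.
Qed.

Lemma rot_sum (x y : S) (c d : R) : c ^+ 2 + d ^+ 2 = 1 ->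
  (c%:C *: x + d%:C *: y) * (c%:C *: x + d%:C *: y)^† +
  (c%:C *: y + (- d)%:C *: x) * (c%:C *: y + (- d)%:C *: x)^† =
  x * x^† + y * y^†.
Proof.
move=> cd; rewrite !dagD !dagZr !mulrDl !mulrDr -!scalerAl -!scalerAr !scalerA.
rewrite -!rmorphM /=.
set X := x * x^†; set Y := y * y^†; set A := x * y^†; set B := y * x^†.
have -> : forall p1 p2 p3 p4 r1 r2 r3 r4 : S,
    p1 + p2 + (p3 + p4) + (r1 + r2 + (r3 + r4)) =
    (p1 + r4) + (p4 + r1) + ((p2 + r3) + (p3 + r2)).
  move=> p1 p2 p3 p4 r1 r2 r3 r4.
  by rewrite [LHS](AC ((2*2)*(2*2)) (((1*8)*(4*5))*((2*7)*(3*6))))/=.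
rewrite -!scalerDl -!rmorphD /=.
have -> : c * d + - d * c = 0 by ring.
have -> : d * c + c * - d = 0 by ring.
rewrite mulrNN -!expr2 [d ^+ 2 + _]addrC cd !scale0r !addr0.
by congr (_ + _); exact: scale1r.
Qed.

(** The loop uses all of the chain except the ranges of up_path: these are
    what the invariant complement consists of, besides the complement of the
    chain. *)
Lemma loop_up_sum :
  \sum_(0 <= a < L) loop_path a * (loop_path a)^† +
  \sum_(0 <= i < K) up_path T M K i * (up_path T M K i)^† =
  \sum_(0 <= i < L + K) T i * (T i)^†.
Proof.
rewrite (sum_nat_add M) (sum_nat_add L).
have -> : \sum_(0 <= i < L) T i * (T i)^† =
    \sum_(0 <= i < K) T i * (T i)^† +
    \sum_(0 <= i < M) T (K + i)%N * (T (K + i)%N)^†.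
  by rewrite addnC sum_nat_add.
rewrite -addrA [in RHS](addrC (\sum_(0 <= i < K) _)) -[RHS]addrA; congr (_ + _).
  by apply: eq_big_nat => a /andP[_ aM]; rewrite loop_path_low 1?ltnW.
rewrite -!big_split /=; apply: eq_bigr => i _.
rewrite loop_path_high [RHS]addrC.
by apply: rot_sum; exact: cos2Dsin2.
Qed.

End Closing.

(** * Towers, their residue classes, and Fourier transforms of families *)

Lemma sum_nat_shift (V : nmodType) n (f : nat -> V) : f n = f 0%N ->
  \sum_(0 <= i < n) f i.+1 = \sum_(0 <= i < n) f i.
Proof.
case: n => [|n] fn; first by rewrite !big_geq.
by rewrite big_nat_recr//= fn [RHS]big_nat_recl// addrC.
Qed.

Section Towers.
Context {R : realType} {S : starAlg R}.
Implicit Types (g : nat -> S) (b : starEndo S).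

Definition ortho_family n g :=
  (forall i, (i < n)%N -> selfadj (g i)) /\
  (forall i j, (i < n)%N -> (j < n)%N -> g i * g j = if i == j then g i else 0).

(** The index n stands for 0, so that shifting never needs a remainder. *)
Definition cyclic_tower b n g :=
  g n = g 0%N /\ forall i, (i < n)%N -> b (g i) = g i.+1.

Definition regroup h l g j : S := \sum_(0 <= t < l) g (j + h * t)%N.

Lemma regroup_cyclic b h l g :
  cyclic_tower b (h * l) g -> cyclic_tower b h (regroup h l g).
Proof.
move=> [gn gS]; split=> [|j hj]; rewrite /regroup.
  under eq_bigr do rewrite -mulnS.
  rewrite (sum_nat_shift (f := fun t => g (h * t)%N)) ?muln0//.
rewrite endo_sum; apply: eq_big_nat => t /andP[_ tl].
rewrite gS ?addSn//.
have : (h * t.+1 <= h * l)%N by rewrite leq_mul2l tl orbT.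
rewrite mulnS; lia.
Qed.

Lemma regroup_ortho h l g : ortho_family (h * l) g ->
  ortho_family h (regroup h l g).
Proof.
move=> [gs go].
have bnd j t : (j < h)%N -> (t < l)%N -> (j + h * t < h * l)%N.
  move=> hj tl; have : (h * t.+1 <= h * l)%N by rewrite leq_mul2l tl orbT.
  by rewrite mulnS; lia.
split=> [j hj|i j hi hj].
  rewrite /selfadj /regroup dag_sum; apply: eq_big_nat => t /andP[_ tl].
  by apply: gs; exact: bnd.
have key (t u : nat) : (j + h * t == i + h * u)%N = (i == j) && (t == u).
  apply/idP/idP => [/eqP e|/andP[/eqP -> /eqP ->]]; last exact: eqxx.
  have e1 : ((h * t + j) %/ h = (h * u + i) %/ h)%N by rewrite addnC e addnC.
  move: e1; rewrite !(mulnC h) !divnMDl; try lia.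
  rewrite !divn_small// !addn0 => tu; move: e; rewrite tu eqxx andbT => e.
  by apply/eqP; lia.
rewrite /regroup mulr_suml.
case: eqP => [ij|/eqP ij].
  subst j; apply: eq_big_nat => t /andP[_ tl]; rewrite mulr_sumr.
  rewrite (sum_nat_single tl) => [|u ul ut]; first by rewrite go ?bnd// eqxx.
  by rewrite go ?bnd// eq_sym key eqxx (negbTE ut).
rewrite big_nat_cond big1// => t /andP[/andP[_ tl] _].
rewrite mulr_sumr big_nat_cond big1// => u /andP[/andP[_ ul] _].
by rewrite go ?bnd// eq_sym key (negbTE ij).
Qed.

Lemma regroup_sum h l g :
  \sum_(0 <= j < h) regroup h l g j = \sum_(0 <= i < h * l) g i.
Proof.
rewrite exchange_big_nat /=; elim: l => [|l ih].
  by rewrite muln0 !big_geq.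
rewrite big_nat_recr//= ih mulnSr sum_nat_add; congr (_ + _).
by apply: eq_bigr => i _; rewrite addnC.
Qed.

Lemma ortho_compl n g : ortho_family n g ->
  isproj (1 - \sum_(0 <= i < n) g i) /\
  forall i, (i < n)%N -> g i * (1 - \sum_(0 <= i < n) g i) = 0 /\
    (1 - \sum_(0 <= i < n) g i) * g i = 0.
Proof.
move=> [sg og]; set G := \sum_(0 <= i < n) g i.
have h i : (i < n)%N -> (1 - G) * g i = 0.
  move=> hi; rewrite mulrBl mul1r mulr_suml (sum_nat_single hi) => [|j hj ji].
    by rewrite og// eqxx subrr.
  by rewrite og// (negbTE ji).
have sG : selfadj (1 - G).
  rewrite /selfadj dagB dag1 dag_sum; congr (_ - _).
  by apply: eq_big_nat => i /andP[_ hi]; exact: sg.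
split; last first.
  move=> i hi; split; last exact: h.
  by rewrite -[LHS]dagK dagM sG sg// h// dag0.
split=> //; rewrite {2}/G mulrBr mulr1 mulr_sumr big_nat_cond big1 ?subr0//.
by move=> i /andP[/andP[_ hi] _]; exact: h.
Qed.

Lemma ortho_family_proj n g i : ortho_family n g -> (i < n)%N -> isproj (g i).
Proof. by move=> [gs go] hi; split; [exact: gs|rewrite go// eqxx]. Qed.

End Towers.

Section Fourier.
Context {R : realType} {S : starAlg R}.
Implicit Types (V G : nat -> S) (b : starEndo S) (s u : S).

(** Orthogonality of the characters of the cyclic group of order n. *)
Lemma cis_orth n (t : R) i j : (0 < n)%N -> (i < n)%N -> (j < n)%N ->
  t = pi *+ 2 / n%:R \/ t = - (pi *+ 2 / n%:R) ->
  \sum_(m < n) cis (- (t *+ i *+ m)) * cis (t *+ j *+ m) =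
  if i == j then n%:R else 0.
Proof.
move=> n0 hi hj ht; case: eqP => [->|/eqP ij].
  under eq_bigr do rewrite cisKN.
  by rewrite sumr_const card_ord.
have [lij|lji|e] := ltngtP i j; last by rewrite e eqxx in ij.
  rewrite -[RHS](@sum_cis R n (j - i) t) ?subn_gt0 ?lij//; last by lia.
  apply: eq_bigr => m _; rewrite -cisD -mulNrn -mulrnDl addrC.
  by rewrite (mulrnBr t (ltnW lij)).
rewrite -[RHS](@sum_cis R n (i - j) (- t)) ?subn_gt0 ?lji//; last first.
- by case: ht => ->; [right|left; rewrite opprK].
- by lia.
apply: eq_bigr => m _; rewrite -cisD -mulNrn -mulrnDl.
by rewrite (mulrnBr (- t) (ltnW lji)) !mulNrn opprK.
Qed.

(** The discrete Fourier transform, unitary when t is 2 pi / n or its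
    opposite. *)
Definition dft n (t : R) V j : S :=
  ((Num.sqrt n%:R)^-1)%:C *: \sum_(m < n) cis (t *+ j *+ m) *: V m.

Lemma sqrtnV n : (0 < n)%N ->
  ((Num.sqrt n%:R)^-1 : R)%:C * ((Num.sqrt n%:R)^-1)%:C * n%:R = 1 :> R[i].
Proof.
move=> n0; rewrite -(rmorph_nat (real_complex R)) -!rmorphM /=.
rewrite -invfM -expr2 sqr_sqrtr// mulVf// pnatr_eq0.
by rewrite -lt0n.
Qed.

Section DFT.
Context (n : nat) (t : R) (V : nat -> S) (s : S).
Hypothesis n0 : (0 < n)%N.
Hypothesis ht : t = pi *+ 2 / n%:R \/ t = - (pi *+ 2 / n%:R).
Hypothesis hV : forall i j, (i < n)%N -> (j < n)%N ->
  (V i)^† * V j = if i == j then s else 0.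

Lemma dft_isom i j : (i < n)%N -> (j < n)%N ->
  (dft n t V i)^† * dft n t V j = if i == j then s else 0.
Proof.
move=> hi hj; rewrite /dft dagZr -scalerAl -scalerAr scalerA dag_sum mulr_suml.
have -> : \sum_(m < n) (cis (t *+ i *+ m) *: V m)^† *
     (\sum_(m < n) cis (t *+ j *+ m) *: V m) =
   (\sum_(m < n) cis (- (t *+ i *+ m)) * cis (t *+ j *+ m)) *: s.
  rewrite scaler_suml; apply: eq_bigr => m _.
  rewrite mulr_sumr (bigD1 m)//= big1 => [|k km].
    by rewrite addr0 dagZ conj_cis -scalerAl -scalerAr scalerA hV// eqxx.
  rewrite -scalerAr dagZ -scalerAl hV// eq_sym.
  by rewrite (negbTE (km : val k != val m)) !scaler0.
rewrite cis_orth//; case: eqP => _; last by rewrite scale0r scaler0.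
by rewrite scalerA sqrtnV// scale1r.
Qed.

Lemma dft_sum :
  \sum_(i < n) dft n t V i * (dft n t V i)^† = \sum_(i < n) V i * (V i)^†.
Proof.
pose r : R[i] := ((Num.sqrt n%:R)^-1)%:C.
have -> : \sum_(i < n) dft n t V i * (dft n t V i)^† =
   \sum_(i < n) \sum_(m < n) \sum_(k < n)
     (r * r * (cis (- (t *+ k *+ i)) * cis (t *+ m *+ i))) *: (V m * (V k)^†).
  apply: eq_bigr => i _.
  rewrite /dft dagZr -scalerAl -scalerAr scalerA mulr_suml scaler_sumr.
  apply: eq_bigr => m _; rewrite dag_sum mulr_sumr scaler_sumr.
  apply: eq_bigr => k _; rewrite dagZ conj_cis -scalerAl -scalerAr !scalerA.
  congr (_ *: _); rewrite -mulrA; congr (_ * _).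
  by rewrite mulrC (mulrnAC t k) (mulrnAC t m).
rewrite exchange_big; apply: eq_bigr => m _ /=.
rewrite exchange_big (bigD1 m)//= [X in _ + X]big1 => [|k km]; last first.
  rewrite -scaler_suml -mulr_sumr cis_orth//.
  by rewrite (negbTE (km : val k != val m)) mulr0 scale0r.
by rewrite addr0 -scaler_suml -mulr_sumr cis_orth// eqxx sqrtnV// scale1r.
Qed.

Lemma dft_src j : (forall i, (i < n)%N -> V i * s = V i) ->
  dft n t V j * s = dft n t V j.
Proof.
move=> hs; rewrite /dft -scalerAl mulr_suml; congr (_ *: _).
by apply: eq_bigr => i _; rewrite -scalerAl hs.
Qed.

Lemma dft_periodic : dft n t V n = dft n t V 0.
Proof.
congr (_ *: _); apply: eq_bigr => m _; congr (_ *: _).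
rewrite mulr0n mul0rn cis0 cisMn.
suff -> : cis (t *+ n) = 1 by rewrite expr1n.
have e : (pi *+ 2 / n%:R : R) *+ n = pi *+ 2.
  by rewrite -[LHS]mulr_natr divfK// pnatr_eq0 -lt0n.
case: ht => ->; rewrite ?mulNrn e ?cis_2pi//.
by have := cisKN (pi *+ 2 : R); rewrite cis_2pi mulr1.
Qed.

End DFT.
End Fourier.

(** * Merging an invariant projection into a cyclic tower *)

Section Absorption.
Context {R : realType} {S : starAlg R} (b : starEndo S) (J : nat).
Context (G : nat -> S) (Y : S).
Hypothesis J0 : (0 < J)%N.
Hypothesis hY : isproj Y.
Hypothesis bY : b Y = Y.
Hypothesis bG : cyclic_tower b J G.
Hypothesis GG : forall i j, (i < J)%N -> (j < J)%N ->
  (G i)^† * G j = if i == j then Y else 0.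
Hypothesis GY : forall i, (i < J)%N -> G i * Y = G i.
Hypothesis YG : forall i, (i < J)%N -> Y * G i = 0.

Local Notation z := (pi *+ 2 / J%:R : R).
Local Notation w := (pi *+ 2 / J.+1%:R : R).

(** The Fourier transform diagonalises the cyclic shift on G; Y is a further
    eigenvector. Its eigenvalue 1 is written as cis (2 pi J / J), so that the
    eigenvalues are cis (2 pi m / J) for m = 0, ..., J. *)
Definition eigen_vec m : S := if (m < J)%N then dft J (- z) G m else Y.

(** Replaces each eigenvalue cis (2 pi m / J) by cis (2 pi m / (J + 1)). *)
Definition absorb_op : S :=
  phase_op (fun m : 'I_J.+1 => eigen_vec m) (fun m => cis (w *+ m - z *+ m)).

(** Transforming back with J + 1 terms turns the corrected eigenvectors into a
    cyclic family of length J + 1. *)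
Definition absorb_vec : nat -> S := dft J.+1 w eigen_vec.

Let hz : - z = pi *+ 2 / J%:R \/ - z = - (pi *+ 2 / J%:R).
Proof. by right. Qed.

Let hw : w = pi *+ 2 / J.+1%:R \/ w = - (pi *+ 2 / J.+1%:R).
Proof. by left. Qed.

Lemma angleMn n : (0 < n)%N -> (pi *+ 2 / n%:R : R) *+ n = pi *+ 2.
Proof. by move=> n0; rewrite -[LHS]mulr_natr divfK// pnatr_eq0 -lt0n. Qed.

Lemma cisN2piMn m : cis (- (pi *+ 2 *+ m) : R) = 1.
Proof.
by have := cisKN (pi *+ 2 *+ m : R); rewrite (cisMn (pi *+ 2)) cis_2pi expr1n mulr1.
Qed.

Lemma eigen_vec_endo m : (m < J.+1)%N ->
  b (eigen_vec m) = cis (z *+ m) *: eigen_vec m.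
Proof.
rewrite /eigen_vec ltnS leq_eqVlt => /predU1P[->|mJ].
  by rewrite ltnn bY angleMn// cis_2pi scale1r.
rewrite mJ /dft endoZ scalerA (mulrC (cis _)) -scalerA; congr (_ *: _).
rewrite endo_sum scaler_sumr.
pose f i := (cis (z *+ m) * cis (- z *+ m *+ i)) *: G i.
transitivity (\sum_(i < J) f i.+1).
  apply: eq_bigr => i _; rewrite endoZ bG.2// /f; congr (_ *: _).
  by rewrite -cisD (mulrS (- z *+ m)) addrA (mulNrn z m) addrN add0r.
rewrite -(big_mkord predT (fun i => f i.+1)) sum_nat_shift.
  by rewrite big_mkord; apply: eq_bigr => i _; rewrite /f scalerA.
rewrite /f bG.1 mulr0n cis0 mulr1; congr (_ *: _).
by rewrite (mulrnAC (- z) m J) (mulNrn z J) angleMn// mulNrn cisN2piMn mulr1.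
Qed.

Lemma eigen_vecM i j : (i < J.+1)%N -> (j < J.+1)%N ->
  (eigen_vec i)^† * eigen_vec j = if i == j then Y else 0.
Proof.
have h k : (Y * dft J (- z) G k) = 0.
  rewrite /dft -scalerAr mulr_sumr big1 ?scaler0// => m _.
  by rewrite -scalerAr YG ?scaler0.
rewrite /eigen_vec !ltnS => hi hj.
case: ltnP => iJ; case: ltnP => jJ.
- exact: dft_isom.
- rewrite -[LHS]dagK dagM dagK hY.1 h dag0; case: eqP => //; lia.
- rewrite hY.1 h; case: eqP => //; lia.
rewrite hY.1 hY.2; case: eqP => //; lia.
Qed.

Lemma eigen_vec_src i : eigen_vec i * Y = eigen_vec i.
Proof.
by rewrite /eigen_vec; case: ltnP => _; [exact: dft_src|exact: hY.2].
Qed.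

Lemma eigen_isofam : isofam Y (fun m : 'I_J.+1 => eigen_vec m).
Proof.
by split=> [i j|i]; [rewrite eigen_vecM|exact: eigen_vec_src].
Qed.

Lemma absorb_unitary : isunitary absorb_op.
Proof.
apply: (phase_op_unitary eigen_isofam) => m.
by rewrite conj_cis mulrC cisKN.
Qed.

(** The m-th angle is corrected by - (m / J) (2 pi / (J + 1)), so the J + 1
    squares sum to O(1 / J). *)
Lemma absorb_near nu : cstarSeminorm nu ->
  nu (absorb_op - 1) ^+ 2 <= w ^+ 2 *+ J.+1.
Proof.
move=> hnu; apply: le_trans (phase_op_near eigen_isofam _ hnu) _.
have -> : w ^+ 2 *+ J.+1 = \sum_(m < J.+1) w ^+ 2.
  by rewrite sumr_const card_ord.
apply: ler_sum => m _; apply: le_trans (sqr_normc_cisB1 _) _.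
have JR : 0 < (J%:R : R) by rewrite ltr0n.
have J1R : 0 < (J.+1%:R : R) by rewrite ltr0n.
have -> : w *+ m - z *+ m = - (m%:R / J%:R) * w.
  rewrite -[w *+ m]mulr_natr -[z *+ m]mulr_natr.
  rewrite -natr1; field; rewrite natr1 !pnatr_eq0.
  by rewrite -!lt0n J0.
rewrite exprMn sqrrN -[leRHS]mul1r ler_wpM2r ?sqr_ge0//.
rewrite -[leRHS](expr1n _ 2) ler_sqr ?nnegrE ?divr_ge0 ?ler0n//.
by rewrite ler_pdivrMr// mul1r ler_nat -ltnS.
Qed.

Lemma absorb_op_fix x : Y * x = 0 ->
  (forall i, (i < J)%N -> (G i)^† * x = 0) -> absorb_op * x = x.
Proof.
move=> Yx Gx; apply: phase_op_orth => m; rewrite /eigen_vec.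
case: ltnP => _; last by rewrite hY.1.
rewrite /dft dagZr -scalerAl dag_sum mulr_suml big1 ?scaler0// => i _.
by rewrite dagZ -scalerAl Gx ?scaler0.
Qed.

Lemma absorb_vec_step j : absorb_op * b (absorb_vec j) = absorb_vec j.+1.
Proof.
rewrite /absorb_vec /dft endoZ -scalerAr endo_sum mulr_sumr; congr (_ *: _).
apply: eq_bigr => m _; rewrite endoZ eigen_vec_endo// -!scalerAr.
rewrite (phase_op_vec eigen_isofam) !scalerA; congr (_ *: _).
rewrite -!cisD; congr cis; rewrite (mulrS w) (mulrnDl m).
by rewrite -addrA [z *+ m + _]addrC subrK addrC.
Qed.

(** The invariant projection Y, which had height one, is spread evenly over
    the J + 1 levels of the new tower. *)
Lemma absorb_tower (hu : isunitary absorb_op) :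
  let F j := absorb_vec j * (absorb_vec j)^† in
  [/\ ortho_family J.+1 F, cyclic_tower (Ad hu b) J.+1 F &
      \sum_(0 <= j < J.+1) F j = \sum_(0 <= j < J) G j * (G j)^† + Y].
Proof.
move=> F.
have iso i j : (i < J.+1)%N -> (j < J.+1)%N ->
    (absorb_vec i)^† * absorb_vec j = if i == j then Y else 0.
  by move=> hi hj; apply: dft_isom => //; exact: eigen_vecM.
have src i : absorb_vec i * Y = absorb_vec i.
  by apply: dft_src => k _; exact: eigen_vec_src.
split.
- split=> [i _|i j hi hj]; first by rewrite /selfadj dagM dagK.
  rewrite /F mulrA -(mulrA (absorb_vec i)) iso//.
  by case: eqP => [->|_]; rewrite ?src// mulr0 mul0r.
- split=> [|i _]; first by rewrite /F /absorb_vec dft_periodic.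
  rewrite /F /= endoM endo_dag mulrA absorb_vec_step.
  by rewrite -mulrA -dagM absorb_vec_step.
rewrite big_mkord /F dft_sum// big_ord_recr /= /eigen_vec ltnn.
rewrite hY.1 hY.2; congr (_ + _); rewrite big_mkord.
under eq_bigr do rewrite ltn_ord.
exact: dft_sum.
Qed.

End Absorption.

(** * From a stack to a cycle with an invariant complement *)

(** What is kept of the first crossing: a cycle d of length n = 2 J (J + 1)
    and a partial isometry P that carries the invariant complement of d into
    the levels 0, 2 J, 4 J, ... The last two fields say that the range of P
    lies in the residue class of 0 modulo 2 J and modulo J. *)
Record closed_system (R : realType) (S : starAlg R) (g : starEndo S) (J n : nat)
    (d : nat -> S) (P : S) : Prop := ClosedSystem {
  cs_length : n = (2 * J * J.+1)%N;
  cs_ortho : ortho_family n d;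
  cs_cyclic : cyclic_tower g n d;
  cs_src : P^† * P = 1 - \sum_(0 <= a < n) d a;
  cs_srcM : P * (1 - \sum_(0 <= a < n) d a) = P;
  cs_range : (1 - \sum_(0 <= a < n) d a) * P = 0;
  cs_double : regroup (2 * J) J.+1 d 0 * P = P;
  cs_single : regroup J (2 * J.+1) d 0 * P = P }.

Section CoreTowers.
Context {R : realType} {S : starAlg R} (b : starEndo S) (q p : S) (J : nat).
Local Notation M1 := (2 * J * J.+1 - J)%N.
Local Notation L := (M1 + J)%N.
Definition level i : S := iter i b (q^† * q).
Local Notation e := level.
Hypothesis J0 : (0 < J)%N.
Hypothesis e0e0 : e 0%N * e 0%N = e 0%N.
Hypothesis q_range : q * q^† = e 1%N.
Hypothesis q_src : q * e 0%N = q.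
Hypothesis e_orth : forall i j, (i < L + J)%N -> (j < L + J)%N -> i != j ->
  e i * e j = 0.
Hypothesis p_src : p^† * p = 1 - \sum_(0 <= i < L + J) e i.
Hypothesis p_iso : p * (p^† * p) = p.
Hypothesis p_range : e 0%N * p = p.

(** b^(i-1)(q) ... b(q) q, an equivalence from level 0 to level i. *)
Fixpoint level_iso i : S := if i is i'.+1 then b (level_iso i') * q else e 0%N.
Local Notation T := level_iso.

Lemma e_selfadj i : selfadj (e i).
Proof.
elim: i => [|i ih]; first by rewrite /selfadj /level /= dagM dagK.
by rewrite /selfadj /level /= -endo_dag -/(level i) ih.
Qed.

Lemma level_iso_src i : T i * e 0%N = T i.
Proof. by case: i => [|i]; [exact: e0e0|rewrite /= -mulrA q_src]. Qed.

Lemma level_iso_dagM i : (T i)^† * T i = e 0%N.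
Proof.
elim: i => [|i ih]; first by rewrite /= [X in X * _]dagM dagK; exact: e0e0.
rewrite /= dagM -endo_dag mulrA -(mulrA q^†) -endoM ih.
rewrite -[b _]/(e 1%N) -q_range mulrA -mulrA; exact: e0e0.
Qed.

Lemma level_iso_Mdag i : T i * (T i)^† = e i.
Proof.
elim: i => [|i ih]; first by rewrite e_selfadj.
rewrite /= dagM -endo_dag mulrA -(mulrA (b _)) q_range.
by rewrite -[e 1%N]/(b (e 0%N)) -!endoM level_iso_src ih.
Qed.

Lemma e_shifted i : e i * T i = T i.
Proof. by rewrite -level_iso_Mdag -mulrA level_iso_dagM level_iso_src. Qed.

Lemma level_iso_chain : chain b (e 0%N) q T (L + J).
Proof.
split=> //; first by split; [exact: e_selfadj|].
  exact: level_iso_src.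
move=> i j hi hj; case: eqP => [->|/eqP ij]; first exact: level_iso_dagM.
rewrite -(e_shifted i) -(e_shifted j) dagM e_selfadj mulrA -(mulrA (T i)^†).
by rewrite e_orth// mulr0 mul0r.
Qed.

Lemma p_shifted i : (i < L + J)%N -> p * T i = 0.
Proof.
move=> hi.
suff h : p * e i = 0 by rewrite -e_shifted mulrA h mul0r.
rewrite -p_iso p_src -mulrA mulrBl mul1r mulr_suml.
rewrite (sum_nat_single hi) => [|j hj ji]; last by rewrite e_orth.
by rewrite -{3}(level_iso_Mdag i) mulrA e_shifted level_iso_Mdag subrr mulr0.
Qed.

Local Notation v2 := (cross_op T M1 J).
Let hv2 : isunitary v2 := cross_unitary level_iso_chain.
Local Notation g2 := (Ad hv2 b).
Local Notation loop := (loop_path T M1 J).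
Local Notation d := (fun a => loop a * (loop a)^†).

Lemma loop_src a : loop a * e 0%N = loop a.
Proof. exact: loop_path_src level_iso_chain a. Qed.

Lemma loopM a c : (a < L)%N -> (c < L)%N ->
  (loop a)^† * loop c = if a == c then e 0%N else 0.
Proof. by move=> ha hc; apply: (loop_pathM level_iso_chain). Qed.

Lemma loop_ortho : ortho_family L d.
Proof.
split=> [i _|i j hi hj]; first by rewrite /selfadj dagM dagK.
rewrite mulrA -(mulrA (loop i)) loopM//.
by case: eqP => [->|_]; rewrite ?loop_src// mulr0 mul0r.
Qed.

Lemma loop_cyclic : cyclic_tower g2 L d.
Proof.
split=> [|a ha]; first by rewrite (loop_path_closed _ _ J0).
have h := loop_path_step level_iso_chain ha.
rewrite /= endoM endo_dag mulrA h -mulrA -dagM h dagM dagK mulrA.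
by rewrite -(mulrA _ q^†) loop_src.
Qed.

Definition core_rest : S := 1 - \sum_(0 <= a < L) d a.
Local Notation Y := core_rest.

Lemma core_rest_loop c : (c < L)%N -> Y * loop c = 0.
Proof.
move=> hc; have [_ /(_ c hc)[_ h]] := ortho_compl loop_ortho.
have -> : loop c = d c * loop c by rewrite -mulrA loopM// eqxx loop_src.
by rewrite mulrA h mul0r.
Qed.

(** The invariant complement is the sum of J projections equivalent to e 0,
    the ranges of up_path, and of the source of p; piece i carries the i-th
    summand into e 0. *)
Definition piece i : S := if (i < J)%N then (up_path T M1 J i)^† else p.

Lemma piece_e0 i : e 0%N * piece i = piece i.
Proof.
rewrite /piece; case: ltnP => _; last exact: p_range.
by rewrite -[e 0%N]e_selfadj -dagM (up_path_src level_iso_chain).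
Qed.

Lemma piece_loop i c : (c < L)%N -> piece i * loop c = 0.
Proof.
rewrite /piece => hc; case: ltnP => hi; first exact: (up_loop_pathM level_iso_chain).
rewrite /loop_path; case: leqP => hcM; first by rewrite p_shifted//; lia.
rewrite /down_path mulrDr -!scalerAr !p_shifted; try lia.
by rewrite !scaler0 addr0.
Qed.

Lemma piece_rest i : piece i * Y = piece i.
Proof.
rewrite mulrBr mulr1 mulr_sumr big_nat_cond big1 ?subr0// => a /andP[/andP[_ ha] _].
by rewrite mulrA piece_loop// mul0r.
Qed.

Lemma piece_sum : \sum_(0 <= i < J.+1) (piece i)^† * piece i = Y.
Proof.
rewrite big_nat_recr//=.
have -> : (piece J)^† * piece J = p^† * p by rewrite /piece ltnn.
rewrite p_src.
have -> : \sum_(0 <= i < J) (piece i)^† * piece i =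
    \sum_(0 <= i < J) up_path T M1 J i * (up_path T M1 J i)^†.
  by apply: eq_big_nat => i /andP[_ hi]; rewrite /piece hi dagK.
have := loop_up_sum T M1 J.
have -> : \sum_(0 <= i < L + J) T i * (T i)^† = \sum_(0 <= i < L + J) e i.
  by apply: eq_bigr => i _; exact: level_iso_Mdag.
by move=> <-; rewrite addrC opprD addrA subrK.
Qed.

Lemma block_lt i : (i < J.+1)%N -> (2 * J * i < L)%N.
Proof.
move=> hi; have : (2 * J * i.+1 <= 2 * J * J.+1)%N by rewrite leq_mul2l hi orbT.
by rewrite mulnS; lia.
Qed.

(** Each of the J + 1 pieces gets a level of its own. The distance 2 J between
    these levels leaves room for 2 J successive images of embed with
    orthogonal ranges. *)
Definition embed : S := \sum_(0 <= i < J.+1) loop (2 * J * i) * piece i.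

Lemma embedM : embed^† * embed = Y.
Proof.
rewrite -piece_sum /embed dag_sum mulr_suml.
apply: eq_big_nat => i /andP[_ hi]; rewrite mulr_sumr.
have bi := block_lt hi.
rewrite (sum_nat_single hi) => [|j hj ji].
  by rewrite dagM mulrA -(mulrA _ (loop _)^†) loopM// eqxx -mulrA piece_e0.
rewrite dagM mulrA -(mulrA _ (loop _)^†) loopM ?block_lt//.
rewrite eqn_mul2l (eq_sym i) (negbTE ji) orbF.
by case: eqP => [|_]; [lia|rewrite mulr0 mul0r].
Qed.

Lemma embed_rest : embed * Y = embed.
Proof.
rewrite mulr_suml; apply: eq_bigr => i _.
by rewrite -mulrA piece_rest.
Qed.

Lemma rest_embed : Y * embed = 0.
Proof.
rewrite mulr_sumr big_nat_cond big1// => i /andP[/andP[_ hi] _].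
by rewrite mulrA core_rest_loop ?block_lt// mul0r.
Qed.

Lemma embed_regroup h l t : (h * l = L)%N -> (0 < h)%N -> (2 * J = h * t)%N ->
  regroup h l d 0 * embed = embed.
Proof.
move=> hl h0 ht; rewrite mulr_sumr; apply: eq_big_nat => i /andP[_ hi].
rewrite mulrA; congr (_ * _); rewrite /regroup mulr_suml.
have bi := block_lt hi.
have til : (t * i < l)%N.
  by rewrite -(ltn_pmul2l h0) mulnA -ht hl.
rewrite (sum_nat_single til) => [|u hu ut].
  by rewrite add0n mulnA -ht -mulrA loopM// eqxx loop_src.
rewrite add0n -mulrA loopM//; last by rewrite -hl ltn_pmul2l.
have -> : (h * u == 2 * J * i)%N = false; last by rewrite mulr0.
by rewrite ht -mulnA eqn_mul2l (negbTE ut) orbF; lia.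
Qed.

Lemma closed_system_exists : exists v (hv : isunitary v) n d P,
  (forall nu, cstarSeminorm nu ->
     nu (v - 1) ^+ 2 <= (rot_angle J : R) ^+ 2 *+ (2 * J)) /\
  closed_system (Ad hv b) J n d P.
Proof.
exists v2, hv2, L, d, embed; split.
  by move=> nu hnu; exact: (cross_near level_iso_chain hnu).
have LE : L = (2 * J * J.+1)%N by rewrite subnK// mulnS; lia.
have LE2 : (J * (2 * J.+1))%N = L by rewrite LE; lia.
split.
- exact: LE.
- exact: loop_ortho.
- exact: loop_cyclic.
- exact: embedM.
- exact: embed_rest.
- exact: rest_embed.
- by apply: (@embed_regroup _ _ 1); [exact: esym LE|lia|rewrite muln1].
- by apply: (@embed_regroup _ _ 2); [exact: LE2|exact: J0|rewrite mulnC].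
Qed.

End CoreTowers.

(** * Two exact towers of coprime heights *)

Section Splicing.
Context {R : realType} {S : starAlg R} (g : starEndo S) (J : nat).
Context (n : nat) (d : nat -> S) (P : S).
Hypothesis J0 : (0 < J)%N.
Hypothesis hd : closed_system g J n d P.

Definition rest : S := 1 - \sum_(0 <= a < n) d a.
Local Notation Y := rest.

Lemma rest_proj : isproj Y.
Proof. exact: (ortho_compl (cs_ortho hd)).1. Qed.

Lemma rest_selfadj : selfadj Y.
Proof. exact: rest_proj.1. Qed.

Lemma rest_d a : (a < n)%N -> Y * d a = 0.
Proof. by move=> ha; have [_ h] := (ortho_compl (cs_ortho hd)).2 a ha. Qed.

Lemma rest_fixed : g Y = Y.
Proof.
rewrite endoB endo1 endo_sum; congr (_ - _).
rewrite -(sum_nat_shift (f := d)); last exact: (cs_cyclic hd).1.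
by apply: eq_big_nat => a /andP[_ ha]; rewrite (cs_cyclic hd).2.
Qed.

Definition copy i : S := iter i g P.

Lemma copy_src i : copy i * Y = copy i.
Proof.
elim: i => [|i ih]; first exact: (cs_srcM hd).
by rewrite /copy /= -{1}rest_fixed -endoM -/(copy i) ih.
Qed.

Lemma rest_copy i : Y * copy i = 0.
Proof.
elim: i => [|i ih]; first exact: (cs_range hd).
by rewrite /copy /= -{1}rest_fixed -endoM -/(copy i) ih endo0.
Qed.

Lemma copy_dagM i : (copy i)^† * copy i = Y.
Proof.
elim: i => [|i ih]; first exact: (cs_src hd).
by rewrite /copy /= -endo_dag -endoM -/(copy i) ih rest_fixed.
Qed.

Let nD : n = (2 * J * J.+1)%N. Proof. exact: cs_length hd. Qed.
Let nS : n = (J * (2 * J.+1))%N. Proof. by rewrite nD mulnA (mulnC J). Qed.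

Local Notation D := (regroup (2 * J) J.+1 d).
Local Notation E := (regroup J (2 * J.+1) d).

Lemma double_ortho : ortho_family (2 * J) D.
Proof. by apply: regroup_ortho; rewrite -nD; exact: (cs_ortho hd). Qed.

Lemma double_cyclic : cyclic_tower g (2 * J) D.
Proof. by apply: regroup_cyclic; rewrite -nD; exact: (cs_cyclic hd). Qed.

Lemma single_ortho : ortho_family J E.
Proof. by apply: regroup_ortho; rewrite -nS; exact: (cs_ortho hd). Qed.

Lemma single_cyclic : cyclic_tower g J E.
Proof. by apply: regroup_cyclic; rewrite -nS; exact: (cs_cyclic hd). Qed.

Lemma double_copy i : (i < 2 * J)%N -> D i * copy i = copy i.
Proof.
elim: i => [|i ih] hi; first exact: (cs_double hd).
rewrite -double_cyclic.2; last exact: ltnW.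
by rewrite /copy /= -endoM -/(copy i) ih// ltnW.
Qed.

(** The ranges of the first 2 J copies lie in different residue classes modulo
    2 J of the cycle d. *)
Lemma copy_chain : chain g Y Y copy (0 + J + J).
Proof.
split.
- exact: rest_proj.
- by rewrite rest_proj.1 rest_proj.2.
- by rewrite rest_proj.1 rest_proj.2 rest_fixed.
- by move=> i; rewrite -[g _]/(copy i.+1) copy_src.
- exact: copy_src.
move=> i j hi hj; case: eqP => [->|/eqP ij]; first exact: copy_dagM.
have h2 : (0 + J + J = 2 * J)%N by lia.
rewrite h2 in hi hj.
rewrite -(double_copy hi) -(double_copy hj) dagM double_ortho.1//.
rewrite mulrA -(mulrA (copy i)^†) double_ortho.2// (negbTE ij) mulr0.
exact: mul0r.
Qed.

Lemma single_copy i : E (i %% J)%N * copy i = copy i.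
Proof.
elim: i => [|i ih]; first by rewrite mod0n; exact: (cs_single hd).
have -> : E (i.+1 %% J)%N = g (E (i %% J)%N).
  rewrite single_cyclic.2 ?ltn_mod// -[i.+1]addn1 -modnDml addn1.
  have : ((i %% J).+1 <= J)%N by rewrite ltn_mod.
  rewrite leq_eqVlt => /predU1P[e|h]; last by rewrite modn_small.
  by rewrite e modnn single_cyclic.1.
by rewrite /copy /= -endoM -/(copy i) ih.
Qed.

Lemma single_copy_eq i j : (j < J)%N ->
  E j * copy i = if j == (i %% J)%N then copy i else 0.
Proof.
move=> hj; rewrite -single_copy mulrA single_ortho.2 ?ltn_mod//.
case: eqP => [->|_]; last by rewrite mul0r.
by rewrite single_copy.
Qed.

Local Notation v3 := (cross_op copy 0 J).
Let hv3 : isunitary v3 := cross_unitary copy_chain.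
Local Notation g3 := (Ad hv3 g).
Local Notation G := (loop_path copy 0 J).

Lemma loop_copyE i : G i = down_path copy 0 J i.
Proof. by rewrite -[i in LHS]add0n loop_path_high. Qed.

Lemma cross_rest : v3 * Y = Y.
Proof.
apply: cross_op_fix => i _; split.
  by rewrite -[LHS]dagK dagM dagK rest_selfadj rest_copy dag0.
by rewrite -[LHS]dagK dagM dagK rest_selfadj rest_copy dag0.
Qed.

Lemma rest_cross : Y * v3^† = Y.
Proof. by rewrite -{1}rest_selfadj -dagM cross_rest rest_selfadj. Qed.

Lemma crossed_rest : g3 Y = Y.
Proof. by rewrite /= rest_fixed cross_rest rest_cross. Qed.

Lemma loop_copy_src i : G i * Y = G i.
Proof. exact: (loop_path_src copy_chain). Qed.

Lemma rest_loop_copy i : Y * G i = 0.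
Proof.
by rewrite loop_copyE /down_path mulrDr -!scalerAr !rest_copy !scaler0 addr0.
Qed.

Lemma loop_copyM i j : (i < J)%N -> (j < J)%N ->
  (G i)^† * G j = if i == j then Y else 0.
Proof. by move=> hi hj; apply: (loop_pathM copy_chain); rewrite add0n. Qed.

Lemma loop_copy_cyclic : cyclic_tower g3 J G.
Proof.
split=> [|i hi]; first by have := loop_path_closed copy 0 J0; rewrite add0n.
have hi' : (i < 0 + J)%N by [].
rewrite /= (loop_path_step copy_chain hi') rest_selfadj -mulrA rest_cross.
exact: loop_copy_src.
Qed.

Lemma single_loop_copy i j : (i < J)%N -> (j < J)%N ->
  E i * G j = if i == j then G j else 0.
Proof.
move=> hi hj; rewrite loop_copyE /down_path mulrDr -!scalerAr.
rewrite !single_copy_eq// add0n modnDl modn_small//.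
by case: eqP => // _; rewrite !scaler0 addr0.
Qed.

(** The planes in which the rotation acts are spanned by copy i and copy (J +
    i), which lie in the same residue class modulo J. *)
Lemma cross_single j : (j < J)%N -> v3 * E j = E j * v3.
Proof.
move=> hj; apply: cross_op_comm; first exact: single_ortho.1.
move=> i hi; rewrite !single_copy_eq// add0n modnDl.
by case: eqP => _; [left|right].
Qed.

Lemma crossed_single : cyclic_tower g3 J E.
Proof.
split=> [|j hj]; first exact: single_cyclic.1.
have h : v3 * E j.+1 = E j.+1 * v3.
  move: hj; rewrite leq_eqVlt => /predU1P[->|hj]; last exact: cross_single.
  by rewrite single_cyclic.1 cross_single.
by rewrite /= single_cyclic.2// h -mulrA hv3.2 mulr1.
Qed.

Definition tower_rest j : S := E j - G j * (G j)^†.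
Local Notation f := tower_rest.

Lemma tower_rest_cyclic : cyclic_tower g3 J f.
Proof.
split=> [|j hj]; first by rewrite /f crossed_single.1 loop_copy_cyclic.1.
by rewrite endoB endoM endo_dag crossed_single.2// loop_copy_cyclic.2.
Qed.

Lemma tower_restE j : (j < J)%N -> f j = (1 - G j * (G j)^†) * E j.
Proof.
move=> hj; rewrite mulrBl mul1r -mulrA.
by rewrite -[_^† * E j]dagK dagM dagK single_ortho.1// single_loop_copy// eqxx.
Qed.

Lemma tower_rest_ortho : ortho_family J f.
Proof.
have sf j : (j < J)%N -> selfadj (f j).
  by move=> hj; rewrite /selfadj dagB single_ortho.1// dagM dagK.
split=> // i j hi hj.
have fG : f i * (G j * (G j)^†) = 0.
  rewrite mulrA mulrBl single_loop_copy// -mulrA loop_copyM//.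
  by case: eqP => [->|_]; rewrite ?loop_copy_src ?mulr0 ?subr0 ?subrr mul0r.
rewrite {2}/f mulrBr fG subr0.
rewrite tower_restE// -mulrA single_ortho.2//.
by case: eqP => _; [|rewrite mulr0].
Qed.

Lemma tower_rest_sum :
  \sum_(0 <= j < J) f j + \sum_(0 <= j < J) G j * (G j)^† = 1 - Y.
Proof.
rewrite -big_split /=; under eq_bigr do rewrite subrK.
by rewrite regroup_sum -nS /rest opprB addrC subrK.
Qed.

(** The loop of copies and Y are merged into a tower of height J + 1; the
    unitary used for that fixes tower_rest, which keeps height J. *)
Lemma towers_exist : exists v (hv : isunitary v) f F,
  [/\ forall nu eta, cstarSeminorm nu -> 0 <= eta ->
        (rot_angle J : R) ^+ 2 *+ (2 * J) <= eta ^+ 2 ->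
        (pi *+ 2 / J.+1%:R : R) ^+ 2 *+ J.+1 <= eta ^+ 2 ->
        nu (v - 1) <= 2 * eta,
      ortho_family J f /\ cyclic_tower (Ad hv g) J f,
      ortho_family J.+1 F /\ cyclic_tower (Ad hv g) J.+1 F &
      \sum_(0 <= j < J) f j + \sum_(0 <= j < J.+1) F j = 1].
Proof.
pose u := absorb_op J G Y.
have G1 i j : (i < J)%N -> (j < J)%N -> (G i)^† * G j = if i == j then Y else 0.
  exact: loop_copyM.
have G2 i : (i < J)%N -> G i * Y = G i by move=> _; exact: loop_copy_src.
have G3 i : (i < J)%N -> Y * G i = 0 by move=> _; exact: rest_loop_copy.
have hY := rest_proj.
have hu : isunitary u by exact: absorb_unitary.
pose F j := absorb_vec J G Y j * (absorb_vec J G Y j)^†.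
have [F1 F2 F3] : [/\ ortho_family J.+1 F, cyclic_tower (Ad hu g3) J.+1 F &
    \sum_(0 <= j < J.+1) F j = \sum_(0 <= j < J) G j * (G j)^† + Y].
  by apply: absorb_tower => //; [exact: crossed_rest|exact: loop_copy_cyclic].
have AdE x : Ad (unitaryM hu hv3) g x = Ad hu g3 x.
  by rewrite /= dagM !mulrA.
exists (u * v3), (unitaryM hu hv3), f, F; split.
- move=> nu eta hnu e0 e1 e2.
  have -> : u * v3 - 1 = u * (v3 - 1) + (u - 1).
    by rewrite mulrBr mulr1 addrA subrK.
  apply: le_trans (csnD hnu _ _) _; rewrite mulr_natl mulr2n lerD//.
    apply: le_trans (csnM hnu _ _) _.
    apply: (@le_trans _ _ (nu (v3 - 1))).
      rewrite -[leRHS]mul1r ler_wpM2r// ?(csn_ge0 hnu)//.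
      exact: csn_unitary.
    rewrite -(@ler_pXn2r _ 2) ?nnegrE ?(csn_ge0 hnu)//.
    exact: le_trans (cross_near copy_chain hnu) e1.
  rewrite -(@ler_pXn2r _ 2) ?nnegrE ?(csn_ge0 hnu)//.
  by apply: le_trans e2; exact: absorb_near.
- split; first exact: tower_rest_ortho.
  split=> [|j hj]; first exact: tower_rest_cyclic.1.
  have ufix k : (k < J)%N -> u * f k = f k.
    move=> hk; apply: absorb_op_fix => //.
      rewrite /f mulrBr mulrA rest_loop_copy mul0r subr0 /regroup mulr_sumr.
      rewrite big_nat_cond big1// => t /andP[/andP[_ ht] _].
      rewrite rest_d// nS.
      have : (J * t.+1 <= J * (2 * J.+1))%N by rewrite leq_mul2l ht orbT.
      by rewrite mulnS; lia.
    move=> i hi; rewrite /f mulrBr mulrA loop_copyM//.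
    rewrite -[_^† * E k]dagK dagM dagK single_ortho.1// single_loop_copy//.
    rewrite eq_sym; case: eqP => [->|_]; last by rewrite dag0 mul0r subr0.
    by rewrite -[Y]rest_selfadj -dagM loop_copy_src subrr.
  have ufS : u * f j.+1 = f j.+1.
    move: hj; rewrite leq_eqVlt => /predU1P[->|hj]; last exact: ufix.
    by rewrite tower_rest_cyclic.1 ufix.
  have sfS : (f j.+1)^† = f j.+1.
    move: hj; rewrite leq_eqVlt => /predU1P[->|hj]; last exact: tower_rest_ortho.1.
    by rewrite tower_rest_cyclic.1 tower_rest_ortho.1.
  rewrite AdE -[LHS]/(u * g3 (f j) * u^†) tower_rest_cyclic.2// ufS.
  by rewrite -{1}sfS -dagM ufS sfS.
- split=> //; split=> [|j hj]; first exact: F2.1.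
  by rewrite AdE F2.2.
by rewrite F3 addrA tower_rest_sum subrK.
Qed.

End Splicing.

(** * Towers of heights k and k + 1 *)

(** A property of the length, the height and the accuracy alone: the length N
    has to be known before a stack of that length can be asked for. *)
Definition stack_yields_towers (R : realType) (N k : nat) (eta : R) : Prop :=
  forall (S : starAlg R) (b : starEndo S) (q p : S),
    level b q 0 * level b q 0 = level b q 0 ->
    q * q^† = level b q 1 -> q * level b q 0 = q ->
    (forall i j, (i < N)%N -> (j < N)%N -> i != j ->
      level b q i * level b q j = 0) ->
    p^† * p = 1 - \sum_(0 <= i < N) level b q i ->
    p * (p^† * p) = p -> level b q 0 * p = p ->
  exists v (hv : isunitary v) g0 g1,
    [/\ forall nu, cstarSeminorm nu -> nu (v - 1) <= eta,
        (forall j, (j < k)%N -> isproj (g0 j)) /\ cyclic_tower (Ad hv b) k g0,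
        (forall j, (j < k.+1)%N -> isproj (g1 j)) /\
          cyclic_tower (Ad hv b) k.+1 g1 &
        \sum_(0 <= j < k) g0 j + \sum_(0 <= j < k.+1) g1 j = 1].

Theorem exact_towers (R : realType) (k : nat) (eta : R) : (0 < k)%N -> 0 < eta ->
  exists N, (2 <= N)%N /\ stack_yields_towers N k eta.
Proof.
move=> k0 eta0; pose e := eta / 3.
have e0 : 0 < e by rewrite divr_gt0.
(* All three perturbations are of size at most 2 pi / sqrt J. *)
pose t := Num.bound ((pi *+ 2) ^+ 2 / e ^+ 2 : R).
have tE : (pi *+ 2) ^+ 2 / e ^+ 2 < t%:R.
  by apply: archi_boundP; rewrite divr_ge0 ?sqr_ge0.
(* k divides J, and J + 1 = (k + 1) (1 + k t). *)
pose J := (k * (1 + k.+1 * t))%N.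
have J0 : (0 < J)%N by rewrite muln_gt0 k0.
have tJ : (t <= J)%N.
  rewrite /J; have : (1 * (1 * t) <= k * (k.+1 * t))%N.
    by rewrite leq_mul// leq_mul.
  by rewrite !mul1n mulnDr; lia.
have JR : 0 < (J%:R : R) by rewrite ltr0n.
have big : (pi *+ 2) ^+ 2 / J%:R <= e ^+ 2.
  rewrite ler_pdivrMr// mulrC -ler_pdivrMr ?exprn_gt0//.
  by apply: le_trans (ltW tE) _; rewrite ler_nat.
have h1 : (rot_angle J : R) ^+ 2 *+ (2 * J) <= e ^+ 2.
  apply: le_trans big; rewrite /rot_angle mulnC mulrnA.
  have -> : (pi / 2 / J%:R) ^+ 2 *+ J *+ 2 = (pi ^+ 2 / J%:R) / 2 :> R.
    rewrite -[_ *+ J]mulr_natr -[_ *+ 2]mulr_natr; field.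
    by rewrite pnatr_eq0 -lt0n.
  have -> : (pi *+ 2) ^+ 2 / J%:R = (pi ^+ 2 / J%:R) * 4 :> R.
    by rewrite -mulr_natr; field; rewrite pnatr_eq0 -lt0n.
  have : 0 <= pi ^+ 2 / J%:R :> R by rewrite divr_ge0 ?sqr_ge0.
  lra.
have h2 : (pi *+ 2 / J.+1%:R : R) ^+ 2 *+ J.+1 <= e ^+ 2.
  apply: le_trans big.
  have gen (x : R) m : (0 < m)%N -> (x / m%:R) ^+ 2 *+ m = x ^+ 2 / m%:R.
    by move=> m0; rewrite -[LHS]mulr_natr; field; rewrite pnatr_eq0 -lt0n.
  rewrite gen//.
  by rewrite ler_wpM2l ?sqr_ge0// lef_pV2 ?posrE ?ltr0n// ler_nat.
exists ((2 * J * J.+1 - J + J) + J)%N; split.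
  by rewrite subnK ?mulnS; lia.
move=> S b q p H1 H2 H3 H4 H5 H6 H7.
have [v2 [hv2 [n [d [P [near2 cs]]]]]] :=
  closed_system_exists J0 H1 H2 H3 H4 H5 H6 H7.
have [v1 [hv1 [f [F [near1 [f1 f2] [F1 F2] sum1]]]]] := towers_exist J0 cs.
have AdE x : Ad (unitaryM hv1 hv2) b x = Ad hv1 (Ad hv2 b) x.
  by rewrite /= dagM !mulrA.
have cyc m h : cyclic_tower (Ad hv1 (Ad hv2 b)) m h ->
    cyclic_tower (Ad (unitaryM hv1 hv2) b) m h.
  by case=> c1 c2; split=> // i hi; rewrite AdE c2.
have EJ : (J.+1 = k.+1 * (1 + k * t))%N.
  by rewrite /J !mulnDr !muln1 (mulnCA k); lia.
rewrite EJ in F1 F2 sum1.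
exists (v1 * v2), (unitaryM hv1 hv2), (regroup k (1 + k.+1 * t) f),
  (regroup k.+1 (1 + k * t) F).
split.
- move=> nu hnu.
  have -> : v1 * v2 - 1 = v1 * (v2 - 1) + (v1 - 1).
    by rewrite mulrBr mulr1 addrA subrK.
  have E3 : eta = e + 2 * e by rewrite /e; field.
  rewrite E3; apply: le_trans (csnD hnu _ _) _; rewrite lerD//; last first.
    by apply: near1 => //; exact: ltW.
  apply: le_trans (csnM hnu _ _) _.
  apply: (@le_trans _ _ (nu (v2 - 1))).
    rewrite -[leRHS]mul1r ler_wpM2r// ?(csn_ge0 hnu)//.
    exact: csn_unitary.
  rewrite -(@ler_pXn2r _ 2) ?nnegrE ?(csn_ge0 hnu) ?(ltW e0)//.
  exact: le_trans (near2 _ hnu) h1.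
- split; last by apply/cyc/regroup_cyclic.
  by move=> j hj; apply: ortho_family_proj hj; exact: regroup_ortho.
- split; last by apply/cyc/regroup_cyclic.
  by move=> j hj; apply: ortho_family_proj hj; exact: regroup_ortho.
by rewrite !regroup_sum.
Qed.

(** * Consequences of the C*-identity *)

(** Completeness is asked only for sequences with geometric steps, the only
    ones that occur. *)
Record completeCstarNorm (R : realType) (S : starAlg R) (nu : S -> R) : Prop :=
  CompleteCstarNorm {
  ccn_seminorm : cstarSeminorm nu;
  ccn_eq0 : forall x, nu x = 0 -> x = 0;
  ccn_complete : forall (u : nat -> S) (C r : R), 0 <= r < 1 ->
    (forall n, nu (u n.+1 - u n) <= C * r ^+ n) ->
    exists x, forall e, 0 < e -> exists n0, forall n, (n0 <= n)%N ->
      nu (x - u n) <= e }.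

Section Seminorm.
Context {R : realType} {S : starAlg R} (nu : S -> R).
Hypothesis hnu : cstarSeminorm nu.
Implicit Types x y z c d : S.

Lemma normc_real (a : R) : Normc.normc a%:C = `|a|.
Proof. by rewrite /Normc.normc /= expr0n addr0 sqrtr_sqr. Qed.

Lemma csnZr (a : R) x : nu (a%:C *: x) = `|a| * nu x.
Proof. by rewrite (csnZ hnu) normc_real. Qed.

Lemma csn0 : nu 0 = 0.
Proof. by have := csnZr 0 0; rewrite scale0r normr0 mul0r. Qed.

Lemma csnN x : nu (- x) = nu x.
Proof.
have := csnZr (-1) x; rewrite normrN1 mul1r => <-; congr nu.
by rewrite rmorphN rmorph1 scaleN1r.
Qed.

Lemma csnB x y : nu (x - y) <= nu x + nu y.
Proof. by apply: le_trans (csnD hnu _ _) _; rewrite csnN. Qed.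

Lemma csnBC x y : nu (x - y) = nu (y - x).
Proof. by rewrite -csnN opprB. Qed.

Lemma csn_dag x : nu x^† = nu x.
Proof.
have h y : nu y <= nu y^†.
  have := csn_ge0 hnu y; rewrite le_eqVlt => /predU1P[<-|y0].
    exact: csn_ge0.
  rewrite -(ler_pM2r y0) -expr2 -(csnC hnu); exact: (csnM hnu).
by apply/eqP; rewrite eq_le h andbT -{2}[x]dagK h.
Qed.

Lemma csn1 : nu 1 <= 1.
Proof. exact: csn_proj hnu proj1. Qed.

(** This replaces the spectral radius formula. *)
Lemma csnX2 x k : selfadj x -> nu (x ^+ (2 ^ k)) = nu x ^+ (2 ^ k).
Proof.
move=> sx; have sX n : selfadj (x ^+ n).
  elim: n => [|n ih]; first by rewrite /selfadj expr0 dag1.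
  by rewrite /selfadj [in LHS]exprS dagM ih sx -exprSr.
elim: k => [|k ih]; first by rewrite !expr1.
by rewrite expnSr !exprM -ih -(csnC hnu) sX -expr2.
Qed.

Lemma csnX x n : (0 < n)%N -> nu (x ^+ n) <= nu x ^+ n.
Proof.
case: n => // n _; elim: n => [|n ih]; first by rewrite !expr1.
rewrite exprS [leRHS]exprS; apply: le_trans (csnM hnu _ _) _.
by rewrite ler_wpM2l ?(csn_ge0 hnu).
Qed.

(** Used to remove a constant factor from an estimate of powers. *)
Lemma dblX_bounded (r C : R) : 0 <= r -> (forall k, r ^+ (2 ^ k) <= C) -> r <= 1.
Proof.
move=> r0 hr; rewrite leNgt; apply/negP => r1.
pose d := r - 1; have d0 : 0 < d by rewrite subr_gt0.
have ber n : 1 + n%:R * d <= r ^+ n.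
  elim: n => [|n ih]; first by rewrite mul0r addr0.
  rewrite exprS; apply: (@le_trans _ _ (r * (1 + n%:R * d))); last by rewrite ler_wpM2l.
  have rE : r = 1 + d by rewrite /d addrC subrK.
  have h : 0 <= n%:R * d * d :> R by rewrite !mulr_ge0 ?(ltW d0).
  have -> : r * (1 + n%:R * d) = 1 + n.+1%:R * d + n%:R * d * d.
    by rewrite {1}rE -natr1; ring.
  by rewrite lerDl.
pose k := Num.bound (C / d).
have C0 : 0 <= C by apply: le_trans (hr 0%N); rewrite exprn_ge0.
have kE : C / d < k%:R by apply: archi_boundP; rewrite divr_ge0// ltW.
have := le_trans (ber (2 ^ k)%N) (hr k).
apply/negP; rewrite -ltNge.
move: kE; rewrite ltr_pdivrMr// => kE; apply: lt_trans kE _.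
have : (k <= 2 ^ k)%N by apply: ltnW; exact: ltn_expl.
rewrite -(ler_nat R) => kk.
have : k%:R * d <= (2 ^ k)%:R * d by rewrite ler_wpM2r// ltW.
lra.
Qed.

Lemma csn_half x y C : nu x <= C -> nu y <= C ->
  nu ((2^-1 : R)%:C *: (x + y)) <= C.
Proof.
move=> hx hy; rewrite csnZr ger0_norm ?invr_ge0//.
have := csnD hnu x y; lra.
Qed.

Lemma half_add x : (2^-1 : R)%:C *: (x + x) = x.
Proof.
rewrite scalerDr -scalerDl -rmorphD /=.
have -> : 2^-1 + 2^-1 = 1 :> R by lra.
exact: scale1r.
Qed.

Lemma dagZi x : ('i *: x)^† = - ('i *: x^†).
Proof.
rewrite dagZ -scaleNr; congr (_ *: _).
by rewrite /Num.conj /=; congr (_ +i* _); rewrite ?oppr0.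
Qed.

Lemma sqrti : ('i : R[i]) * 'i = -1.
Proof. by rewrite -expr2 sqr_i. Qed.

(** Commuting self-adjoint elements are the real and imaginary parts of a
    normal element. *)
Lemma normal_dagM c d : selfadj c -> selfadj d -> c * d = d * c ->
  (c + 'i *: d)^† * (c + 'i *: d) = c * c + d * d /\
  (c + 'i *: d) * (c + 'i *: d)^† = c * c + d * d.
Proof.
move=> sc sd cd; rewrite dagD dagZi sc sd; split.
  rewrite mulrDl !mulrDr !mulNr -!scalerAl -!scalerAr scalerA sqrti cd.
  by rewrite scaleN1r opprK addrA -(addrA (c * c)) subrr addr0.
rewrite mulrDl !mulrDr !mulrN -!scalerAl -!scalerAr scalerA sqrti cd.
by rewrite scaleN1r opprK addrA -(addrA (c * c)) addNr addr0.
Qed.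

Lemma normal_re c d : selfadj c -> selfadj d ->
  (2^-1 : R)%:C *: ((c + 'i *: d) + (c + 'i *: d)^†) = c.
Proof.
move=> sc sd; rewrite dagD dagZi sc sd addrACA subrr addr0.
exact: half_add.
Qed.

(** The norm of the real part c is at most that of c + i d, whose square is
    the norm of c^2 + d^2. *)
Lemma csn_commuting c d : selfadj c -> selfadj d -> c * d = d * c ->
  nu c ^+ 2 <= nu (c * c + d * d).
Proof.
move=> sc sd cd; rewrite -(normal_dagM sc sd cd).1 (csnC hnu).
rewrite ler_pXn2r ?nnegrE ?(csn_ge0 hnu)//.
rewrite -{1}(normal_re sc sd); apply: csn_half => //.
by rewrite csn_dag.
Qed.

End Seminorm.

(** * Square roots, polar parts and contractivity of endomorphisms *)

Section CstarAnalysis.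
Context {R : realType} {S : starAlg R} (nu : S -> R).
Hypothesis hc : completeCstarNorm nu.
Implicit Types x y z a c r w : S.

Let hnu := ccn_seminorm hc.

Lemma csn_eq0_small x (C : R) : (forall e, 0 < e -> nu x <= C * e) -> x = 0.
Proof.
move=> h; apply: (ccn_eq0 hc); apply/eqP; rewrite eq_le (csn_ge0 hnu) andbT.
apply/ler_addgt0Pr => e e0; rewrite add0r.
have C1 : 0 < `|C| + 1 by rewrite ltr_pwDr.
apply: le_trans (h (e / (`|C| + 1)) _) _; first exact: divr_gt0.
have CC : C <= `|C| + 1 by have := ler_norm C; lra.
by rewrite mulrA ler_pdivrMr// (mulrC e) ler_wpM2r// ltW.
Qed.

Definition limit_of x (u : nat -> S) :=
  forall e, 0 < e -> exists n0, forall n, (n0 <= n)%N -> nu (x - u n) <= e.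

Lemma limit_of_near x u e : limit_of x u -> 0 < e ->
  exists n, nu (x - u n) <= e /\ nu (x - u n.+1) <= e.
Proof. by move=> h e0; have [n hn] := h e e0; exists n; rewrite !hn. Qed.

Lemma limit_of_commute x u z : limit_of x u ->
  (forall n, u n * z = z * u n) -> x * z = z * x.
Proof.
move=> hx hu; apply/eqP; rewrite -subr_eq0; apply/eqP.
apply: (@csn_eq0_small _ (2 * nu z)) => e e0.
have [n [hn _]] := limit_of_near hx e0.
have -> : x * z - z * x = (x - u n) * z - z * (x - u n).
  by rewrite mulrBl mulrBr hu opprB addrA subrK.
apply: le_trans (csnB hnu _ _) _.
have h1 := csnM hnu (x - u n) z; have h2 := csnM hnu z (x - u n).
have h3 : nu (x - u n) * nu z <= e * nu z by rewrite ler_wpM2r ?(csn_ge0 hnu).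
rewrite mulrC in h3; rewrite mulrC in h1; lra.
Qed.

Lemma limit_of_selfadj x u : limit_of x u ->
  (forall n, selfadj (u n)) -> selfadj x.
Proof.
move=> hx hu; apply/eqP; rewrite -subr_eq0; apply/eqP.
apply: (@csn_eq0_small _ 2) => e e0.
have [n [hn _]] := limit_of_near hx e0.
have -> : x^† - x = (x - u n)^† - (x - u n) by rewrite dagB hu opprB addrA subrK.
apply: le_trans (csnB hnu _ _) _; rewrite (csn_dag hnu); lra.
Qed.

Lemma limit_of_le x u (C : R) : limit_of x u -> (forall n, nu (u n) <= C) ->
  nu x <= C.
Proof.
move=> hx hu; apply/ler_addgt0Pr => e e0.
have [n [hn _]] := limit_of_near hx e0.
have -> : x = (x - u n) + u n by rewrite subrK.
by apply: le_trans (csnD hnu _ _) _; rewrite addrC lerD.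
Qed.

(** Iteration of y = (r + y^2) / 2, whose fixed points satisfy (1 - y)^2 = 1 -
    r. *)
Fixpoint sqrt_iter r n : S :=
  if n is n'.+1 then (2^-1 : R)%:C *: (r + sqrt_iter r n' * sqrt_iter r n')
  else 0.

(** The iterates are polynomials in r of norm at most nu r, so that the
    iteration contracts by the factor nu r < 1; as limits of polynomials,
    roots commute with whatever commutes with r. *)
Lemma sqrt_exists r : selfadj r -> nu r < 1 -> exists y,
  [/\ selfadj y, nu y <= nu r, (1 - y) * (1 - y) = 1 - r &
      forall z, r * z = z * r -> y * z = z * y].
Proof.
move=> sr r1; set rho := nu r in r1 *.
have rho0 : 0 <= rho by exact: csn_ge0.
pose u := sqrt_iter r.
have uS n : u n.+1 = (2^-1 : R)%:C *: (r + u n * u n) by [].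
have su n : selfadj (u n).
  elim: n => [|n ih]; first exact: dag0.
  by rewrite /selfadj uS dagZr dagD dagM ih sr.
have cu z n : r * z = z * r -> u n * z = z * u n.
  move=> rz; elim: n => [|n ih]; first by rewrite mul0r mulr0.
  rewrite uS -scalerAl -scalerAr mulrDl mulrDr rz; congr (_ *: (_ + _)).
  by rewrite -mulrA ih mulrA ih mulrA.
have cuu m n : u m * u n = u n * u m.
  by apply: (cu (u n) m); rewrite (cu r n).
have bu n : nu (u n) <= rho.
  elim: n => [|n ih]; first by rewrite (csn0 hnu).
  rewrite uS; apply: (csn_half hnu) => //.
  apply: le_trans (csnM hnu _ _) _; rewrite -[leRHS]mulr1.
  by apply: ler_pM => //; rewrite ?(csn_ge0 hnu)//; apply: le_trans ih (ltW r1).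
have du n : nu (u n.+1 - u n) <= 1 * rho ^+ n.
  rewrite mul1r; elim: n => [|n ih].
    by rewrite subr0; apply: le_trans (bu 1%N) (ltW r1).
  have -> : u n.+2 - u n.+1 =
      (2^-1 : R)%:C *: ((u n.+1 - u n) * (u n.+1 + u n)).
    rewrite uS [u n.+1 in X in _ - X]uS -scalerBr; congr (_ *: _).
    rewrite opprD addrACA subrr add0r mulrBl !mulrDr (cuu n n.+1).
    by rewrite opprD addrA addrK.
  rewrite (csnZr hnu) ger0_norm ?invr_ge0//.
  have h1 := csnM hnu (u n.+1 - u n) (u n.+1 + u n).
  have h2 : nu (u n.+1 + u n) <= 2 * rho.
    by apply: le_trans (csnD hnu _ _) _; have := bu n; have := bu n.+1; lra.
  have h3 : nu (u n.+1 - u n) * nu (u n.+1 + u n) <= rho ^+ n * (2 * rho).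
    by apply: ler_pM => //; exact: csn_ge0.
  rewrite exprSr; lra.
have rho01 : 0 <= rho < 1 by rewrite rho0.
have [y hy] := ccn_complete hc rho01 du.
have by_ : nu y <= rho by exact: limit_of_le hy bu.
exists y; split=> //.
- exact: limit_of_selfadj hy su.
- have ye : y = (2^-1 : R)%:C *: (r + y * y).
    apply/eqP; rewrite -subr_eq0; apply/eqP.
    apply: (@csn_eq0_small _ 2) => e e0.
    have [n [h0 h1]] := limit_of_near hy e0.
    have -> : y - (2^-1 : R)%:C *: (r + y * y) =
       (y - u n.+1) - (2^-1 : R)%:C *: ((y - u n) * y + u n * (y - u n)).
      rewrite uS -addrA; congr (_ + _); rewrite -opprD -scalerDr.
      congr (- (_ *: _)); rewrite -addrA; congr (_ + _).
      by rewrite mulrBl mulrBr [RHS]addrC addrA !subrK.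
    apply: le_trans (csnB hnu _ _) _.
    suff : nu ((2^-1 : R)%:C *: ((y - u n) * y + u n * (y - u n))) <= e by lra.
    apply: (csn_half hnu); apply: le_trans (csnM hnu _ _) _.
      rewrite -[leRHS]mulr1; apply: ler_pM => //; rewrite ?(csn_ge0 hnu)//.
      exact: le_trans by_ (ltW r1).
    rewrite -[leRHS]mul1r; apply: ler_pM => //; rewrite ?(csn_ge0 hnu)//.
    exact: le_trans (bu n) (ltW r1).
  have y2 : y + y = r + y * y.
    by rewrite {1 2}ye -scalerDr half_add.
  rewrite mulrBl mul1r mulrBr mulr1 -addrA -opprD; congr (_ - _).
  by rewrite addrA y2 addrK.
- by move=> z rz; apply: limit_of_commute hy _ => n; exact: cu.
Qed.

Fixpoint neumann_iter y n : S :=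
  if n is n'.+1 then 1 + y * neumann_iter y n' else 1.

Lemma inverse_exists y : nu y <= 2^-1 -> exists x,
  [/\ x * (1 - y) = 1, (1 - y) * x = 1, nu (x - 1) <= 2 * nu y &
      forall z, y * z = z * y -> x * z = z * x].
Proof.
move=> y1; pose u := neumann_iter y.
have uS n : u n.+1 = 1 + y * u n by [].
have cu z n : y * z = z * y -> u n * z = z * u n.
  move=> yz; elim: n => [|n ih]; first by rewrite mul1r mulr1.
  by rewrite uS mulrDl mulrDr mul1r mulr1 -mulrA ih mulrA yz mulrA.
have yge0 : 0 <= nu y by exact: csn_ge0.
have du n : nu (u n.+1 - u n) <= 1 * 2^-1 ^+ n.
  elim: n => [|n ih].
    rewrite /u /= mulr1 addrC addKr; lra.
  have -> : u n.+2 - u n.+1 = y * (u n.+1 - u n).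
    by rewrite uS [u n.+1 in X in _ - X]uS opprD addrACA subrr add0r mulrBr.
  apply: le_trans (csnM hnu _ _) _; rewrite mul1r exprS.
  by rewrite mul1r in ih; apply: ler_pM; rewrite ?(csn_ge0 hnu).
have h01 : 0 <= (2^-1 : R) < 1 by apply/andP; split; lra.
have [x hx] := ccn_complete hc h01 du.
have cx z : y * z = z * y -> x * z = z * x.
  by move=> yz; apply: limit_of_commute hx _ => n; exact: cu.
have xe : x = 1 + y * x.
  apply/eqP; rewrite -subr_eq0; apply/eqP.
  apply: (@csn_eq0_small _ 2) => e e0.
  have [n [h0 h1]] := limit_of_near hx e0.
  have -> : x - (1 + y * x) = (x - u n.+1) - y * (x - u n).
    rewrite uS mulrBr opprB opprD -!addrA; congr (_ + _).
    rewrite opprD -!addrA; congr (_ + _).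
    by rewrite addrA addNr add0r.
  apply: le_trans (csnB hnu _ _) _.
  have : nu (y * (x - u n)) <= 2^-1 * e.
    by apply: le_trans (csnM hnu _ _) _; apply: ler_pM; rewrite ?(csn_ge0 hnu).
  lra.
have bx : nu x <= 2.
  have : nu x <= 1 + nu y * nu x.
    rewrite {1}xe; apply: le_trans (csnD hnu _ _) _; apply: lerD.
      exact: csn1.
    exact: csnM.
  have : nu y * nu x <= 2^-1 * nu x by rewrite ler_wpM2r// (csn_ge0 hnu).
  lra.
have yx : x * y = y * x by exact: cx.
exists x; split=> //.
- by rewrite mulrBr mulr1 yx {1}xe addrK.
- by rewrite mulrBl mul1r {1}xe addrK.
- have -> : x - 1 = y * x by rewrite {1}xe addrC addKr.
  apply: le_trans (csnM hnu _ _) _; rewrite mulrC.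
  by rewrite ler_wpM2r.
Qed.

(** The polar part z (z^† z)^(-1/2). An intertwining relation z a = c z with a
    and c self-adjoint makes a commute with z^† z, hence with its square root,
    and so passes to the unitary. *)
Lemma polar_unitary z (d : R) : nu (z - 1) <= d -> d <= 1 / 8 -> exists v,
  [/\ isunitary v, nu (v - 1) <= 8 * d &
      forall a c, selfadj a -> selfadj c -> z * a = c * z -> v * a * v^† = c].
Proof.
move=> zd d8; have d0 : 0 <= d by apply: le_trans zd; exact: csn_ge0.
pose k := z - 1; have zE : z = 1 + k by rewrite addrC subrK.
pose r := 1 - z^† * z.
have rE : r = - (k^† + k + k^† * k).
  rewrite /r zE dagD dag1 mulrDl mul1r mulrDr mulr1.
  by rewrite opprD addrA opprD addrA subrr add0r -opprD addrA (addrC k).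
have sr : selfadj r by rewrite /selfadj dagB dag1 dagM dagK.
have nr : nu r <= 3 * d.
  rewrite rE (csnN hnu); apply: le_trans (csnD hnu _ _) _.
  have h1 := csnD hnu k^† k; have h2 := csnC hnu k.
  have h3 : nu k ^+ 2 <= d.
    rewrite expr2; apply: (@le_trans _ _ (d * 1)); last by rewrite mulr1.
    by apply: ler_pM; rewrite ?(csn_ge0 hnu)//; rewrite /k; lra.
  rewrite (csn_dag hnu) in h1; have : nu k <= d by [].
  lra.
have r1 : nu r < 1 by lra.
have [y [sy ny y2 cy]] := sqrt_exists sr r1.
have y1 : nu y <= 2^-1 by lra.
have [h [h1 h2 nh ch]] := inverse_exists y1.
have sh : selfadj h.
  have : h^† * (1 - y) = 1.
    by have := congr1 (@dag R S) h2; rewrite dagM dagB dag1 sy.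
  move=> e; rewrite /selfadj -[LHS]mulr1 -h2 mulrA e; exact: mul1r.
have gE : (1 - y) * (1 - y) = z^† * z by rewrite y2 /r opprB addrC subrK.
have vv : (z * h)^† * (z * h) = 1.
  rewrite dagM sh mulrA -(mulrA h) -gE mulrA h1 mul1r; exact: h2.
have nk : nu (- k) <= 2^-1 by rewrite (csnN hnu); rewrite /k; lra.
have [w [w1 w2 _ _]] := inverse_exists nk.
rewrite opprK -zE in w1 w2.
have vg : (z * h) * ((1 - y) * w) = 1.
  by rewrite mulrA -(mulrA z) h1 mulr1.
have vd : (z * h)^† = (1 - y) * w.
  by rewrite -[LHS]mulr1 -{1}vg mulrA vv mul1r.
have hv : isunitary (z * h) by split=> //; rewrite vd.
exists (z * h); split=> //.
- have -> : z * h - 1 = z * (h - 1) + k.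
    by rewrite mulrBr mulr1 /k addrA subrK.
  apply: le_trans (csnD hnu _ _) _.
  have nz : nu z <= 1 + d.
    by rewrite zE; apply: le_trans (csnD hnu _ _) _; rewrite lerD// csn1.
  have : nu (z * (h - 1)) <= (1 + d) * (6 * d).
    apply: le_trans (csnM hnu _ _) _; apply: ler_pM; rewrite ?(csn_ge0 hnu)//.
    by apply: le_trans nh _; lra.
  have : nu k <= d by [].
  nra.
- move=> a c sa sc zac.
  have ra : r * a = a * r.
    rewrite /r mulrBl mulrBr mul1r mulr1; congr (_ - _).
    rewrite -mulrA zac mulrA -{1}sc -dagM -zac dagM sa.
    by rewrite mulrA.
  have ha : h * a = a * h by apply: ch; exact: cy.
  by rewrite -(mulrA z) ha mulrA zac -mulrA -{2}(mulr1 c) -hv.2 !mulrA.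
Qed.

Lemma csn_endo_unitary (b : starEndo S) u : isunitary u -> nu (b u) <= 1.
Proof.
move=> [u1 u2]; apply: csn_unitary => //.
by split; rewrite -endo_dag -endoM ?u1 ?u2 endo1.
Qed.

(** If nu c < 1 then c + i sqrt (1 - c^2) is unitary with real part c, and
    endomorphisms preserve unitaries. *)
Lemma csn_endo_selfadj (b : starEndo S) a : selfadj a -> nu (b a) <= nu a.
Proof.
move=> sa.
have small c : selfadj c -> nu c < 1 -> nu (b c) <= 1.
  move=> sc c1; have scc : selfadj (c * c) by rewrite /selfadj dagM sc.
  have cc1 : nu (c * c) < 1.
    have := csnC hnu c; rewrite sc => ->; rewrite expr_lt1//; exact: csn_ge0.
  have [y [sy _ y2 cy]] := sqrt_exists scc cc1.
  pose g := 1 - y.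
  have sg : selfadj g by rewrite /selfadj dagB dag1 sy.
  have cg : c * g = g * c.
    by rewrite mulrBr mulrBl mulr1 mul1r cy// mulrA.
  have [e1 e2] := normal_dagM sc sg cg.
  have cg1 : c * c + g * g = 1 by rewrite y2 addrC subrK.
  rewrite cg1 in e1 e2.
  have hu : isunitary (c + 'i *: g) by [].
  rewrite -(normal_re sc sg) endoZ endoD endo_dag; apply: (csn_half hnu).
    exact: csn_endo_unitary.
  by rewrite (csn_dag hnu); exact: csn_endo_unitary.
apply/ler_addgt0Pr => e e0; pose m := nu a + e.
have m0 : 0 < m by rewrite ltr_wpDl// (csn_ge0 hnu).
have : nu (b (m^-1%:C *: a)) <= 1.
  apply: small; first by rewrite /selfadj dagZr sa.
  rewrite (csnZr hnu) ger0_norm ?invr_ge0 ?(ltW m0)// mulrC ltr_pdivrMr// mul1r.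
  by rewrite ltrDl.
rewrite endoZ (csnZr hnu) ger0_norm ?invr_ge0 ?(ltW m0)// mulrC ler_pdivrMr//.
by rewrite mul1r.
Qed.

Lemma csn_endo (b : starEndo S) x : nu (b x) <= nu x.
Proof.
rewrite -(@ler_pXn2r _ 2) ?nnegrE ?(csn_ge0 hnu)// -!(csnC hnu).
rewrite -endo_dag -endoM; apply: csn_endo_selfadj.
by rewrite /selfadj dagM dagK.
Qed.

End CstarAnalysis.

(** * Positivity and the order on projections *)

Section Positivity.
Context {R : realType} {S : starAlg R} (nu : S -> R).
Hypothesis hc : completeCstarNorm nu.
Implicit Types x y z a b c d r t u e : S.

Let hnu := ccn_seminorm hc.

(** Positivity expressed by the norm: for self-adjoint t, the spectrum lies in
    [0, 2 K]. Sums are then obvious, while membership of elements b^† b is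
    not. *)
Definition npos t := exists2 K : R, 0 < K & nu (K%:C *: 1 - t) <= K.

Lemma nposW t K K' : K <= K' -> nu (K%:C *: 1 - t) <= K ->
  nu (K'%:C *: 1 - t) <= K'.
Proof.
move=> KK h.
have -> : K'%:C *: 1 - t = (K' - K)%:C *: 1 + (K%:C *: 1 - t).
  by rewrite addrA -scalerDl -rmorphD /= subrK.
apply: le_trans (csnD hnu _ _) _; rewrite (csnZr hnu) ger0_norm ?subr_ge0//.
have : (K' - K) * nu 1 <= (K' - K) * 1.
  by rewrite ler_wpM2l ?subr_ge0// csn1.
lra.
Qed.

Lemma nposD t u : npos t -> npos u -> npos (t + u).
Proof.
move=> [K K0 hK] [H H0 hH]; exists (K + H); first exact: addr_gt0.
have -> : (K + H)%:C *: 1 - (t + u) = (K%:C *: 1 - t) + (H%:C *: 1 - u).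
  by rewrite rmorphD scalerDl opprD addrACA.
by apply: le_trans (csnD hnu _ _) _; rewrite lerD.
Qed.

Lemma nposZ t (m : R) : 0 < m -> npos t -> npos (m%:C *: t).
Proof.
move=> m0 [K K0 hK]; exists (m * K); first exact: mulr_gt0.
by rewrite rmorphM -scalerA -scalerBr (csnZr hnu) ger0_norm ?(ltW m0)// ler_pM2l.
Qed.

(** With g = sqrt (1 - c^2 / K) one has K - c^2 = K g^2, and g^2 <= g^2 + c^2
    / K = 1. *)
Lemma npos_sqr c : selfadj c -> npos (c * c).
Proof.
move=> sc; pose K := nu (c * c) + 1.
have K0 : 0 < K by rewrite ltr_pwDr// (csn_ge0 hnu).
pose m := Num.sqrt K^-1.
have mm : m * m = K^-1 by rewrite -expr2 sqr_sqrtr// invr_ge0 ltW.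
pose c' := m%:C *: c.
have sc' : selfadj c' by rewrite /selfadj dagZr sc.
have c'c' : c' * c' = (K^-1)%:C *: (c * c).
  by rewrite /c' -scalerAl -scalerAr scalerA -rmorphM /= mm.
have scc : selfadj (c' * c') by rewrite /selfadj dagM sc'.
have n1 : nu (c' * c') < 1.
  rewrite c'c' (csnZr hnu) ger0_norm ?invr_ge0 ?(ltW K0)// mulrC.
  by rewrite ltr_pdivrMr// mul1r /K ltrDl.
have [y [sy _ y2 cy]] := sqrt_exists hc scc n1.
exists K => //.
have sg : selfadj (1 - y) by rewrite /selfadj dagB dag1 sy.
have cg : (1 - y) * c' = c' * (1 - y).
  by rewrite mulrBr mulrBl mulr1 mul1r cy// mulrA.
have := csn_commuting hnu sg sc' cg; rewrite y2 subrK => h.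
have -> : K%:C *: 1 - c * c = K%:C *: ((1 - y) * (1 - y)).
  by rewrite y2 c'c' scalerBr scalerA -rmorphM /= divff ?gt_eqF// scale1r.
rewrite (csnZr hnu) ger0_norm ?(ltW K0)// -[leRHS]mulr1 ler_pM2l//.
have := csnC hnu (1 - y); rewrite sg => ->.
exact: le_trans h (csn1 hnu).
Qed.

(** For 0 < l < 1 the element 1 - l (1 + u^2) has a square root g, and then l
    u^2 <= l u^2 + g^2 = 1 - l in norm; let l tend to 1. *)
Lemma one_add_sqr_le1 u : selfadj u -> nu (1 + u * u) <= 1 -> u = 0.
Proof.
move=> su h.
have key (l : R) : 0 < l < 1 -> l * nu u ^+ 2 <= 1 - l.
  move=> /andP[l0 l1]; pose m := Num.sqrt l.
  have mm : m * m = l by rewrite -expr2 sqr_sqrtr// ltW.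
  pose c := m%:C *: u; have sc : selfadj c by rewrite /selfadj dagZr su.
  have cc : c * c = l%:C *: (u * u).
    by rewrite /c -scalerAl -scalerAr scalerA -rmorphM /= mm.
  pose r := l%:C *: (1 + u * u).
  have sr : selfadj r by rewrite /selfadj dagZr dagD dag1 dagM su.
  have nr : nu r < 1.
    rewrite (csnZr hnu) ger0_norm ?(ltW l0)//.
    have : l * nu (1 + u * u) <= l * 1 by rewrite ler_wpM2l// ltW.
    lra.
  have [y [sy _ y2 cy]] := sqrt_exists hc sr nr.
  have sg : selfadj (1 - y) by rewrite /selfadj dagB dag1 sy.
  have ru : r * c = c * r.
    rewrite /r /c -!scalerAl -!scalerAr mulrDl mulrDr mul1r mulr1.
    by rewrite mulrA !scalerA mulrC.
  have cg : c * (1 - y) = (1 - y) * c.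
    by rewrite mulrBr mulrBl mulr1 mul1r cy.
  have := csn_commuting hnu sc sg cg.
  have -> : c * c + (1 - y) * (1 - y) = (1 - l)%:C *: 1.
    rewrite y2 cc /r scalerDr addrC opprD addrA subrK.
    by rewrite rmorphB rmorph1 scalerBl scale1r.
  rewrite (csnZr hnu (1 - l)) ger0_norm ?subr_ge0 ?(ltW l1)// => h1.
  have : nu c ^+ 2 = l * nu u ^+ 2.
    by rewrite /c (csnZr hnu) exprMn real_normK ?num_real// expr2 mm.
  move=> <-; apply: le_trans h1 _; rewrite -[leRHS]mulr1 ler_wpM2l ?csn1//.
  by rewrite subr_ge0 ltW.
apply: (ccn_eq0 hc); apply/eqP.
set N := nu u in key *.
have N0 : 0 <= N by exact: csn_ge0.
rewrite eq_le N0 andbT leNgt; apply/negP => Np.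
have N2 : 0 < N ^+ 2 by rewrite exprn_gt0.
have d0 : 0 < 1 + N ^+ 2 by lra.
pose l := (1 + N ^+ 2 / 2) / (1 + N ^+ 2).
have l1 : 0 < l < 1.
  apply/andP; split; first by rewrite /l divr_gt0//; lra.
  by rewrite /l ltr_pdivrMr//; lra.
have := key l l1.
have -> : 1 - l = l * N ^+ 2 - N ^+ 2 / 2.
  by rewrite /l; field; rewrite gt_eqF.
lra.
Qed.

(** Parallelogram identity: 1 + u^2 is the mean of (1 + u)^2 and (1 - u)^2. *)
Lemma one_pm_le1 u : selfadj u -> nu (1 + u) <= 1 -> nu (1 - u) <= 1 -> u = 0.
Proof.
move=> su h1 h2; apply: one_add_sqr_le1 => //.
have sq x : nu x <= 1 -> nu (x * x) <= 1.
  move=> hx; apply: le_trans (csnM hnu _ _) _; rewrite -[leRHS]mulr1.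
  by apply: ler_pM; rewrite ?(csn_ge0 hnu).
have e v : (1 + v) * (1 + v) = 1 + v * v + (v + v).
  by rewrite mulrDl mul1r mulrDr mulr1 [LHS](AC (2*2) ((1*4)*(2*3))).
have -> : 1 + u * u =
    (2^-1 : R)%:C *: ((1 + u) * (1 + u) + (1 - u) * (1 - u)).
  rewrite -[LHS]half_add; congr (_ *: _); rewrite !e mulrNN [RHS]addrACA.
  by rewrite -opprD subrr addr0.
by apply: (csn_half hnu); exact: sq.
Qed.

(** Kaplansky's argument, with norms of powers instead of spectra. Write c = b
    + b^† and d = i (b - b^†); then b b^† = (c^2 + d^2) / 2 + t is positive in
    the sense of npos, so |K - b b^†| <= K. Since b^† (K - b b^†)^m b = - t (K
    + t)^m, the norm of t (K + t)^m is O(K^m), which forces |K + t| <= K. As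
    also |K - t| <= K, t vanishes. *)
Lemma npos_neg_gram b t : selfadj t -> npos t -> b^† * b = - t -> t = 0.
Proof.
move=> st pt bb.
pose c := b + b^†; pose d := 'i *: (b - b^†).
have sc : selfadj c by rewrite /selfadj dagD dagK addrC.
have sd : selfadj d by rewrite /selfadj dagZi dagB dagK -scalerN opprB.
pose Q := b * b^†.
have QE : Q = (2^-1 : R)%:C *: (c * c + d * d) + t.
  rewrite -[t]opprK -bb.
  have -> : c * c + d * d = (Q + b^† * b) + (Q + b^† * b).
    rewrite /c /d -scalerAl -scalerAr scalerA sqrti scaleN1r.
    have -> : (b + b^†) * (b + b^†) = b * b + b * b^† + (b^† * b + b^† * b^†).
      by rewrite mulrDl !mulrDr.
    have -> : (b - b^†) * (b - b^†) = b * b - b * b^† - (b^† * b - b^† * b^†).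
      by rewrite mulrBl !mulrBr.
    rewrite !opprB /Q.
    rewrite [LHS](AC ((2*2)*(2*2)) ((((2*3)*(7*5))*(1*8))*(4*6))).
    by rewrite /= !subrr !addr0.
  by rewrite half_add addrK.
have [K K0 [hK hQ]] : exists2 K : R, 0 < K &
    nu (K%:C *: 1 - t) <= K /\ nu (K%:C *: 1 - Q) <= K.
  have [K K0 hK] := pt.
  have [H H0 hH] : npos Q.
    rewrite QE; apply: nposD => //; apply: nposZ; rewrite ?invr_gt0//.
    by apply: nposD; exact: npos_sqr.
  exists (K + H); first exact: addr_gt0.
  by split; [apply: nposW hK|apply: nposW hH]; rewrite ?lerDl ?lerDr ltW.
pose X := K%:C *: 1 + t.
have XE : X = K%:C *: 1 - b^† * b by rewrite bb opprK.
have sX : selfadj X by rewrite /selfadj dagD dagZr dag1 st.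
have comm m : (K%:C *: 1 - Q) ^+ m * b = b * X ^+ m.
  elim: m => [|m ih]; first by rewrite !expr0 mul1r mulr1.
  rewrite exprS -mulrA ih mulrA exprS mulrA; congr (_ * _).
  by rewrite XE mulrBl mulrBr -scalerAl -scalerAr mul1r mulr1 mulrA.
have tX m : (0 < m)%N -> nu (t * X ^+ m) <= nu b ^+ 2 * K ^+ m.
  move=> m0; have -> : t * X ^+ m = - (b^† * ((K%:C *: 1 - Q) ^+ m * b)).
    by rewrite comm mulrA bb mulNr opprK.
  rewrite (csnN hnu); apply: le_trans (csnM hnu _ _) _.
  rewrite (csn_dag hnu) expr2 -mulrA ler_wpM2l ?(csn_ge0 hnu)//.
  apply: le_trans (csnM hnu _ _) _; rewrite mulrC ler_wpM2l ?(csn_ge0 hnu)//.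
  apply: le_trans (csnX hnu _ m0) _.
  by rewrite lerXn2r ?nnegrE ?(csn_ge0 hnu)// ltW.
pose rho := nu X.
have rho0 : 0 <= rho by exact: csn_ge0.
have rhoK : rho <= K.
  rewrite leNgt; apply/negP => Kr.
  pose s := rho / K.
  have s1 : 1 < s by rewrite ltr_pdivlMr// mul1r.
  have hs : s <= 1; last by move: s1; rewrite ltNge hs.
  apply: (@dblX_bounded _ s (nu b ^+ 2 / K / (s - 1) * s + s)).
    by rewrite divr_ge0// ltW.
  case=> [|k].
    rewrite expr1 lerDr mulr_ge0//; last by rewrite ltW// (lt_trans ltr01).
    by rewrite !divr_ge0 ?sqr_ge0 ?subr_ge0 ?ltW.
  have [m mE] : exists m, (2 ^ k.+1 = m.+2)%N.
    exists (2 ^ k.+1 - 2)%N; have : (2 <= 2 ^ k.+1)%N.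
      by rewrite expnS leq_pmulr// expn_gt0.
    lia.
  have h0 : rho ^+ m.+2 = nu (X ^+ m.+2) by rewrite -mE (csnX2 hnu).
  have h1 : nu (X ^+ m.+2) <= nu b ^+ 2 * K ^+ m.+1 + K * rho ^+ m.+1.
    have -> : X ^+ m.+2 = t * X ^+ m.+1 + K%:C *: X ^+ m.+1.
      by rewrite exprS {1}/X mulrDl addrC -scalerAl mul1r.
    apply: le_trans (csnD hnu _ _) _; apply: lerD; first exact: tX.
    rewrite (csnZr hnu) ger0_norm ?(ltW K0)// ler_pM2l//.
    exact: csnX.
  rewrite -h0 in h1.
  have rE : rho = s * K by rewrite /s divfK// gt_eqF.
  have h2 : s ^+ m.+2 <= nu b ^+ 2 / K + s ^+ m.+1.
    rewrite -(ler_pM2r (exprn_gt0 m.+2 K0)) -exprMn -rE mulrDl.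
    apply: le_trans h1 _; rewrite le_eqVlt; apply/orP; left; apply/eqP.
    rewrite rE exprMn [K ^+ m.+2]exprS; field.
    by rewrite gt_eqF.
  rewrite mE.
  have h3 : s ^+ m.+1 * (s - 1) <= nu b ^+ 2 / K.
    by rewrite mulrBr mulr1 -exprSr lerBlDr.
  rewrite -ler_pdivlMr ?subr_gt0// in h3.
  rewrite exprSr; apply: (@le_trans _ _ (nu b ^+ 2 / K / (s - 1) * s)).
    by rewrite ler_wpM2r// ltW// (lt_trans ltr01).
  by rewrite lerDl ltW// (lt_trans ltr01).
pose u := (K^-1)%:C *: t.
have su : selfadj u by rewrite /selfadj dagZr st.
have scal x : K^-1 * nu x <= 1 -> nu ((K^-1)%:C *: x) <= 1.
  by rewrite (csnZr hnu) ger0_norm ?invr_ge0 ?(ltW K0).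
have KK : (K^-1)%:C *: (K%:C *: 1) = 1 :> S.
  by rewrite scalerA -rmorphM /= mulVf ?scale1r// gt_eqF.
have u0 : u = 0.
  apply: one_pm_le1 => //.
    have -> : 1 + u = (K^-1)%:C *: X by rewrite scalerDr KK.
    by apply: scal; rewrite mulrC ler_pdivrMr// mul1r.
  have -> : 1 - u = (K^-1)%:C *: (K%:C *: 1 - t) by rewrite scalerBr KK.
  by apply: scal; rewrite mulrC ler_pdivrMr// mul1r.
have : K%:C *: u = t.
  by rewrite scalerA -rmorphM /= mulfV ?scale1r// gt_eqF.
by rewrite u0 scaler0.
Qed.

(** Compressing e - r = x^† x by f = 1 - e gives (x f)^† (x f) = - f r f. Here
    f r f is positive in the sense of npos because 1 - f r f is the orthogonal
    sum of e and of f (1 - r) f. *)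
Lemma proj_le e r x : isproj e -> isproj r -> e - r = x^† * x -> e * r = r.
Proof.
move=> [se ee] [sr rr] h; pose f := 1 - e.
have sf : selfadj f by rewrite /selfadj dagB dag1 se.
have ff : f * f = f by rewrite mulrBr mulr1 {2}/f mulrBl mul1r ee subrr subr0.
have fe : f * e = 0 by rewrite mulrBl mul1r ee subrr.
have ef : e * f = 0 by rewrite mulrBr mulr1 ee subrr.
pose t := f * r * f.
have tG : t = (r * f)^† * (r * f) by rewrite dagM sf sr mulrA -(mulrA f) rr.
have st : selfadj t by rewrite tG /selfadj dagM dagK.
have pt : npos t.
  exists 1 => //; rewrite scale1r; pose n := f - t.
  have en : e * n = 0 by rewrite mulrBr ef /t !mulrA ef !mul0r subrr.
  have ne : n * e = 0 by rewrite mulrBl fe /t -mulrA fe mulr0 subrr.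
  have -> : 1 - t = e + n by rewrite addrA [e + f]addrC subrK.
  have nn : nu n <= 1.
    have -> : n = f * ((1 - r) * f).
      by rewrite [(1 - r) * f]mulrBl mul1r mulrBr ff mulrA.
    have h1 := csn_proj hnu (conj sf ff).
    have p2 : isproj (1 - r).
      split; first by rewrite /selfadj dagB dag1 sr.
      by rewrite mulrBr mulr1 mulrBl mul1r rr subrr subr0.
    have h2 := csn_proj hnu p2.
    apply: le_trans (csnM hnu _ _) _; rewrite -[leRHS]mulr1.
    apply: ler_pM; rewrite ?(csn_ge0 hnu)//.
    apply: le_trans (csnM hnu _ _) _; rewrite -[leRHS]mulr1.
    by apply: ler_pM; rewrite ?(csn_ge0 hnu).
  have sn : selfadj (e + n) by rewrite /selfadj dagD dagB se sf st.
  apply: (@dblX_bounded _ _ 2); first exact: csn_ge0.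
  move=> k; rewrite -(csnX2 hnu)//.
  have -> : (e + n) ^+ (2 ^ k) = e + n ^+ (2 ^ k).
    have : (0 < 2 ^ k)%N by rewrite expn_gt0.
    case: (2 ^ k)%N => // j _; elim: j => [|j ih]; first by rewrite !expr1.
    have enj : e * n ^+ j.+1 = 0 by rewrite exprS mulrA en mul0r.
    by rewrite exprS ih mulrDl !mulrDr ee ne enj addr0 add0r -exprS.
  apply: le_trans (csnD hnu _ _) _.
  have h1 := csn_proj hnu (conj se ee).
  have h2 : nu (n ^+ (2 ^ k)) <= 1.
    apply: le_trans (csnX hnu _ _) _; first by rewrite expn_gt0.
    by rewrite exprn_ile1// (csn_ge0 hnu).
  lra.
have bb : (x * f)^† * (x * f) = - t.
  by rewrite dagM sf mulrA -(mulrA f) -h [f * (e - r)]mulrBr fe sub0r mulNr.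
have t0 := npos_neg_gram st pt bb.
have rf : r * f = 0.
  apply: (ccn_eq0 hc); apply/eqP; rewrite -sqrf_eq0 -(csnC hnu) -tG t0.
  by rewrite (csn0 hnu).
have re : r * e = r.
  by move/eqP: rf; rewrite mulrBr mulr1 subr_eq0 => /eqP <-.
by rewrite -[LHS]dagK dagM se sr re sr.
Qed.

Lemma partial_iso (p : S) : isproj (p^† * p) -> p * (p^† * p) = p.
Proof.
move=> [_ pp]; apply/eqP; rewrite -subr_eq0; apply/eqP.
apply: (ccn_eq0 hc); apply/eqP; rewrite -sqrf_eq0 -(csnC hnu).
set P := p^† * p in pp *.
have sP : P^† = P by rewrite /P dagM dagK.
rewrite dagB dagM sP mulrBl !mulrBr.
have -> : p^† * (p * P) = P by rewrite mulrA.
have -> : P * p^† * p = P by rewrite -mulrA.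
have -> : P * p^† * (p * P) = P by rewrite mulrA -(mulrA P) -/P !pp.
by rewrite -/P !subrr (csn0 hnu).
Qed.

End Positivity.

(** * Straightening an approximate stack *)

Section Perturbation.
Context {R : realType} {S : starAlg R} (nu : S -> R).
Hypothesis hc : completeCstarNorm nu.
Let hnu := ccn_seminorm hc.

(** The polar part of sum_i f_i g_i + (1 - sum f_i) (1 - sum g_i), which is
    close to 1 and carries g_i to f_i. *)
Lemma intertwining_unitary n (f g : nat -> S) (d : R) :
  ortho_family n f -> ortho_family n g ->
  (forall i, (i < n)%N -> nu (f i - g i) <= d) -> d *+ (2 * n) <= 1 / 8 ->
  exists v, [/\ isunitary v, nu (v - 1) <= 8 * (d *+ (2 * n)) &
    forall i, (i < n)%N -> v * g i * v^† = f i].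
Proof.
move=> hf hg hd d8.
have [[sF FF] f0] := ortho_compl hf; have [pG g0] := ortho_compl hg.
set F := 1 - _ in sF FF f0; set G := 1 - _ in pG g0.
pose z := \sum_(0 <= i < n) f i * g i + F * G.
have zg i : (i < n)%N -> z * g i = f i * g i.
  move=> hi; rewrite mulrDl -mulrA (g0 i hi).2 mulr0 addr0 mulr_suml.
  rewrite (sum_nat_single hi) => [|j hj ji].
    by rewrite -mulrA hg.2// eqxx.
  by rewrite -mulrA hg.2// (negbTE ji) mulr0.
have fz i : (i < n)%N -> f i * z = f i * g i.
  move=> hi; rewrite mulrDr mulrA (f0 i hi).1 mul0r addr0 mulr_sumr.
  rewrite (sum_nat_single hi) => [|j hj ji].
    by rewrite mulrA hf.2// eqxx.
  by rewrite mulrA hf.2// eq_sym (negbTE ji) mul0r.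
have zE : z - 1 = \sum_(0 <= i < n) (f i - g i) * g i + (F - G) * G.
  under eq_bigr do rewrite mulrBl; rewrite sumrB mulrBl pG.2.
  rewrite addrACA -opprD; congr (_ - _).
  have -> : \sum_(0 <= i < n) g i * g i = \sum_(0 <= i < n) g i.
    by apply: eq_big_nat => i /andP[_ hi]; rewrite hg.2// eqxx.
  by rewrite addrC subrK.
have zn : nu (z - 1) <= d *+ (2 * n).
  rewrite zE mul2n -addnn mulrnDr; apply: le_trans (csnD hnu _ _) _.
  have sumd : \sum_(0 <= i < n) nu (f i - g i) <= d *+ n.
    have -> : d *+ n = \sum_(0 <= i < n) d by rewrite sumr_const_nat subn0.
    by apply: ler_sum_nat => i /andP[_ hi]; exact: hd.
  apply: lerD.
    apply: le_trans (csn_sum hnu _ _ _) _; apply: le_trans sumd.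
    apply: ler_sum_nat => i /andP[_ hi]; apply: le_trans (csnM hnu _ _) _.
    rewrite -[leRHS]mulr1 ler_wpM2l ?(csn_ge0 hnu)//.
    by apply: csn_proj => //; exact: ortho_family_proj hi.
  apply: le_trans (csnM hnu _ _) _.
  apply: (@le_trans _ _ (nu (F - G) * 1)).
    by rewrite ler_wpM2l ?(csn_ge0 hnu)// csn_proj.
  rewrite mulr1 /F /G opprB addrC addrA subrK -sumrB.
  apply: le_trans (csn_sum hnu _ _ _) _; apply: le_trans sumd.
  by apply: ler_sum_nat => i _; rewrite (csnBC hnu).
have [v [hv nv Hv]] := polar_unitary hc zn d8.
exists v; split=> // i hi; apply: Hv; [exact: hg.1|exact: hf.1|].
by rewrite zg// fz.
Qed.

End Perturbation.

Section Instance.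
Context {R : realType} (A : cstarAlgType R).

Definition cstarA : starAlg R :=
  @StarAlg R A (@star R A) (@cstar_starK R A) (@cstar_starD R A)
    (@cstar_starZ R A) (@cstar_starM R A).

Definition nrm (x : A) : R := complex.Re `|x|.

Lemma nrmE (x : A) : `|x| = (nrm x)%:C.
Proof. by rewrite RRe_real// ger0_real. Qed.

Lemma nrm_lt (x : A) (e : R) : (`|x| < e%:C) = (nrm x < e).
Proof. by rewrite nrmE ltcR. Qed.

Lemma nrm_seminorm : @cstarSeminorm R cstarA nrm.
Proof.
split=> [x|x y|x y|c x|x].
- by rewrite -ler0c -nrmE.
- have e : (nrm x + nrm y)%:C = (nrm x)%:C + (nrm y)%:C :> R[i] by exact: rmorphD.
  by rewrite -lecR e -!nrmE; exact: (@ler_normD _ (cstar_sort A)).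
- have e : (nrm x * nrm y)%:C = (nrm x)%:C * (nrm y)%:C :> R[i] by exact: rmorphM.
  by rewrite -lecR e -!nrmE; exact: (@cstar_normM R A).
- have e : (Normc.normc c * nrm x)%:C = `|c| * (nrm x)%:C :> R[i] by exact: rmorphM.
  by apply: complexI; rewrite e -!nrmE; exact: (@normrZ _ (cstar_sort A)).
- have e : (nrm x ^+ 2)%:C = (nrm x)%:C ^+ 2 :> R[i] by exact: rmorphXn.
  by apply: complexI; rewrite e -!nrmE; exact: (@cstar_identity R A).
Qed.

Lemma nrm_complete : @completeCstarNorm R cstarA nrm.
Proof.
split; first exact: nrm_seminorm.
  move=> x x0; apply/eqP; rewrite -normr_eq0 nrmE x0.
  by [].
move=> u C r /andP[r0 r1] hu.
have hn := nrm_seminorm.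
have r1' : 0 < 1 - r by rewrite subr_gt0.
have C0 : 0 <= C.
  by have := le_trans (csn_ge0 hn _) (hu 0%N); rewrite expr0 mulr1.
have tail n m : nrm (u (n + m)%N - u n) <= C / (1 - r) * r ^+ n * (1 - r ^+ m).
  elim: m => [|m ih].
    by rewrite addn0 subrr expr0 subrr mulr0 (csn0 hn).
  have -> : u (n + m.+1)%N - u n =
      (u (n + m).+1 - u (n + m)%N) + (u (n + m)%N - u n).
    by rewrite addnS addrA subrK.
  apply: le_trans (csnD hn _ _) _.
  have -> : C / (1 - r) * r ^+ n * (1 - r ^+ m.+1) =
     C * r ^+ (n + m) + C / (1 - r) * r ^+ n * (1 - r ^+ m).
    by rewrite exprD exprS; field; rewrite gt_eqF.
  by apply: lerD => //; exact: hu.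
have tail1 n m : (n <= m)%N -> nrm (u m - u n) <= C / (1 - r) * r ^+ n.
  move=> nm; rewrite -(subnKC nm); apply: le_trans (tail _ _) _.
  rewrite -[leRHS]mulr1 ler_wpM2l//.
    by rewrite mulr_ge0 ?exprn_ge0// divr_ge0// ltW.
  by rewrite gerBl exprn_ge0.
have small (e : R) : 0 < e -> exists n0, C / (1 - r) * r ^+ n0 <= e.
  move=> e0.
  have /cvgrPdist_le : r ^+ n @[n --> \oo] --> (0 : R).
    by apply: cvg_expr; rewrite ger0_norm.
  pose D := C / (1 - r) + 1.
  have D0 : 0 < D by rewrite ltr_wpDl// divr_ge0// ltW.
  move=> /(_ (e / D)) /(_ (divr_gt0 e0 D0)) [n0 _ h]; exists n0.
  have := h n0 (leqnn n0); rewrite sub0r normrN ger0_norm ?exprn_ge0// => hr.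
  have : D * r ^+ n0 <= e by rewrite mulrC -ler_pdivlMr.
  by apply: le_trans; rewrite ler_wpM2r ?exprn_ge0// lerDl.
pose U : nat -> cstar_sort A := u.
have cU : cvg (U n @[n --> \oo]).
  apply: cauchy_cvg; apply: cauchy_exP => eps eps0.
  have epsE : eps = (complex.Re eps)%:C by rewrite RRe_real// gtr0_real.
  have [n0 hn0] : exists n0, C / (1 - r) * r ^+ n0 <= complex.Re eps / 2.
    by apply: small; rewrite divr_gt0// -ltcR -epsE.
  exists (u n0); exists n0 => // m /= nm; rewrite -ball_normE /=.
  rewrite epsE nrm_lt (csnBC hn); apply: le_lt_trans (tail1 _ _ nm) _.
  apply: le_lt_trans hn0 _; rewrite ltr_pdivrMr// mulr_natr mulr2n ltrDl.
  by rewrite -ltcR -epsE.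
exists (lim (U n @[n --> \oo])) => e e0.
have /cvgrPdist_le/(_ e%:C) := cU; rewrite ltcR => /(_ e0) [n0 _ h].
by exists n0 => n nn; have := h n nn; rewrite nrmE lecR.
Qed.

End Instance.

(** * The algebra of asymptotically central sequences *)

(** The sequences considered are those that asymptotically commute with all
    elements of ctx_test. *)
Record centralContext (R : realType) := CentralContext {
  ctx_alg : starAlg R;
  ctx_nu : ctx_alg -> R;
  ctx_norm : cstarSeminorm ctx_nu;
  ctx_test : ctx_alg -> Prop;
  ctx_test_dag : forall x, ctx_test x -> ctx_test x^† }.

Section AsymptoticallyCentral.
Context {R : realType} (c : centralContext R).
Local Notation S := (ctx_alg c).
Local Notation nu := (@ctx_nu R c).
Local Notation test := (@ctx_test R c).
Let hnu : cstarSeminorm nu := ctx_norm c.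

Definition rate (n : nat) : R := n.+1%:R^-1.

Lemma rate_gt0 n : 0 < rate n.
Proof. by rewrite invr_gt0 ltr0n. Qed.

Definition seq_bounded (u : nat -> S) := exists C, forall n, nu (u n) <= C.

(** A fixed rate of convergence replaces limits: the closure properties below
    become inequalities between constants. *)
Definition seq_null (u : nat -> S) := exists C, forall n, nu (u n) <= C * rate n.

Definition seq_central (u : nat -> S) :=
  seq_bounded u /\ forall x, test x -> seq_null (fun n => x * u n - u n * x).

Lemma seq_bounded_ge0 u : seq_bounded u ->
  exists2 C, 0 <= C & forall n, nu (u n) <= C.
Proof.
move=> [C hC]; exists C => //; exact: le_trans (csn_ge0 hnu _) (hC 0%N).
Qed.

Lemma seq_null_ge0 u : seq_null u ->
  exists2 C, 0 <= C & forall n, nu (u n) <= C * rate n.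
Proof.
move=> [C hC]; exists C => //.
by rewrite -(pmulr_lge0 _ (rate_gt0 0)); apply: le_trans (csn_ge0 hnu _) (hC 0%N).
Qed.

Lemma seq_nullD u w : seq_null u -> seq_null w -> seq_null (fun n => u n + w n).
Proof.
move=> [C hC] [D hD]; exists (C + D) => n.
by apply: le_trans (csnD hnu _ _) _; rewrite mulrDl lerD.
Qed.

Lemma seq_nullMr u w : seq_null u -> seq_bounded w ->
  seq_null (fun n => u n * w n).
Proof.
move=> /seq_null_ge0[C C0 hC] /seq_bounded_ge0[D D0 hD]; exists (C * D) => n.
apply: le_trans (csnM hnu _ _) _; rewrite mulrAC.
by apply: ler_pM => //; exact: csn_ge0.
Qed.

Lemma seq_nullMl u w : seq_bounded w -> seq_null u ->
  seq_null (fun n => w n * u n).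
Proof.
move=> /seq_bounded_ge0[D D0 hD] /seq_null_ge0[C C0 hC]; exists (D * C) => n.
apply: le_trans (csnM hnu _ _) _; rewrite -mulrA.
by apply: ler_pM => //; exact: csn_ge0.
Qed.

Lemma seq_null_ext u w : u =1 w -> seq_null u -> seq_null w.
Proof. by move=> e [C hC]; exists C => n; rewrite -e. Qed.

Lemma seq_centralD u w : seq_central u -> seq_central w ->
  seq_central (fun n => u n + w n).
Proof.
move=> [[C hC] hu] [[D hD] hw]; split.
  by exists (C + D) => n; apply: le_trans (csnD hnu _ _) _; rewrite lerD.
move=> x tx; apply: seq_null_ext (seq_nullD (hu x tx) (hw x tx)) => n /=.
by rewrite mulrDr mulrDl opprD addrACA.
Qed.

Lemma seq_centralM u w : seq_central u -> seq_central w ->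
  seq_central (fun n => u n * w n).
Proof.
move=> [bu hu] [bw hw]; split.
  have [C C0 hC] := seq_bounded_ge0 bu; have [D D0 hD] := seq_bounded_ge0 bw.
  exists (C * D) => n; apply: le_trans (csnM hnu _ _) _.
  by apply: ler_pM => //; exact: csn_ge0.
move=> x tx.
apply: seq_null_ext (seq_nullD (seq_nullMr (hu x tx) bw)
  (seq_nullMl bu (hw x tx))) => n /=.
by rewrite mulrBl mulrBr !mulrA addrA subrK.
Qed.

Lemma seq_centralZ (a : R[i]) u : seq_central u ->
  seq_central (fun n => a *: u n).
Proof.
have a0 : 0 <= Normc.normc a by rewrite -ler0c; exact: (normr_ge0 a).
move=> [[C hC] hu]; split.
  exists (Normc.normc a * C) => n; rewrite (csnZ hnu).
  by rewrite ler_wpM2l.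
move=> x /hu[D hD]; exists (Normc.normc a * D) => n.
rewrite -scalerAr -scalerAl -scalerBr (csnZ hnu) -mulrA.
by rewrite ler_wpM2l.
Qed.

Lemma seq_central_dag u : seq_central u -> seq_central (fun n => (u n)^†).
Proof.
move=> [[C hC] hu]; split; first by exists C => n; rewrite (csn_dag hnu).
move=> x /(@ctx_test_dag R c) /hu[D hD]; exists D => n.
rewrite -(csn_dag hnu) dagB !dagM dagK (csnBC hnu); exact: hD.
Qed.

Lemma seq_central_near1 v : seq_null (fun n => v n - 1) -> seq_central v.
Proof.
move=> hv; have [C C0 hC] := seq_null_ge0 hv; split.
  exists (C + 1) => n; have -> : v n = (v n - 1) + 1 by rewrite subrK.
  apply: le_trans (csnD hnu _ _) _; rewrite lerD ?csn1//.
  apply: le_trans (hC n) _; rewrite -[leRHS]mulr1 ler_wpM2l//.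
  by rewrite invf_le1 ?ltr0n// ler1n.
have cst (x : S) : seq_bounded (fun=> x) by exists (nu x).
have hN : seq_null (fun n => 1 - v n).
  by exists C => n; rewrite (csnBC hnu).
move=> x _; apply: seq_null_ext (seq_nullD (seq_nullMl (cst x) hv)
  (seq_nullMr hN (cst x))) => n /=.
by rewrite mulrBr mulrBl mulr1 mul1r addrA subrK.
Qed.

(** The commutator of x and a (u n) is the image of that of y and u n, if x =
    a y: this is why the test set has to be stable under the inverse of the
    automorphism. *)
Lemma seq_central_endo (a : starEndo S) u :
  (forall x, nu (a x) <= nu x) ->
  (forall x, test x -> exists2 y, test y & a y = x) ->
  seq_central u -> seq_central (fun n => a (u n)).
Proof.
move=> na ta [[C hC] hu]; split; first by exists C => n; exact: le_trans (hC n).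
move=> x /ta[y /hu[D hD] <-]; exists D => n.
by rewrite -!endoM -endoB; exact: le_trans (hD n).
Qed.

Lemma seq_central1 : seq_central (fun=> 1).
Proof.
by apply: seq_central_near1; exists 0 => n; rewrite subrr (csn0 hnu) mul0r.
Qed.

Lemma seq_central0 : seq_central (fun=> 0).
Proof.
split; first by exists 0 => n; rewrite (csn0 hnu).
by move=> x _; exists 0 => n; rewrite mulr0 mul0r subrr (csn0 hnu) mul0r.
Qed.

Lemma seq_centralN u : seq_central u -> seq_central (fun n => - u n).
Proof.
move=> /(seq_centralZ (-1)) h.
suff -> : (fun n => - u n) = (fun n => (-1) *: u n) by [].
by apply/funext => n; rewrite scaleN1r.
Qed.

Record centralSeq := CentralSeq {
  central_fun :> nat -> S;
  central_prop : seq_central central_fun }.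

Lemma centralSeq_ext (u w : centralSeq) : (forall n, u n = w n) -> u = w.
Proof.
case: u w => [u hu] [w hw] /= e; have {}e : u = w by apply/funext.
by case: w / e hw => hw; congr CentralSeq; exact: Prop_irrelevance.
Qed.

HB.instance Definition _ := gen_eqMixin centralSeq.
HB.instance Definition _ := gen_choiceMixin centralSeq.

Definition central_add (u w : centralSeq) :=
  CentralSeq (seq_centralD (central_prop u) (central_prop w)).
Definition central_opp (u : centralSeq) :=
  CentralSeq (seq_centralN (central_prop u)).
Definition central_mul (u w : centralSeq) :=
  CentralSeq (seq_centralM (central_prop u) (central_prop w)).
Definition central_scale (a : R[i]) (u : centralSeq) :=
  CentralSeq (seq_centralZ a (central_prop u)).
Definition central_dag (u : centralSeq) :=
  CentralSeq (seq_central_dag (central_prop u)).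
Definition central_zero := CentralSeq seq_central0.
Definition central_one := CentralSeq seq_central1.

Lemma central_addA : associative central_add.
Proof. by move=> u v w; apply: centralSeq_ext => n /=; rewrite addrA. Qed.
Lemma central_addC : commutative central_add.
Proof. by move=> u v; apply: centralSeq_ext => n /=; rewrite addrC. Qed.
Lemma central_add0 : left_id central_zero central_add.
Proof. by move=> u; apply: centralSeq_ext => n /=; rewrite add0r. Qed.
Lemma central_addN : left_inverse central_zero central_opp central_add.
Proof. by move=> u; apply: centralSeq_ext => n /=; rewrite addNr. Qed.

HB.instance Definition _ := GRing.isZmodule.Build centralSeq
  central_addA central_addC central_add0 central_addN.

Lemma central_mulA : associative central_mul.
Proof. by move=> u v w; apply: centralSeq_ext => n /=; rewrite mulrA. Qed.
Lemma central_mul1l : left_id central_one central_mul.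
Proof. by move=> u; apply: centralSeq_ext => n /=; rewrite mul1r. Qed.
Lemma central_mul1r : right_id central_one central_mul.
Proof. by move=> u; apply: centralSeq_ext => n /=; rewrite mulr1. Qed.
Lemma central_mulDl : left_distributive central_mul central_add.
Proof. by move=> u v w; apply: centralSeq_ext => n /=; rewrite mulrDl. Qed.
Lemma central_mulDr : right_distributive central_mul central_add.
Proof. by move=> u v w; apply: centralSeq_ext => n /=; rewrite mulrDr. Qed.

Lemma central_one_neq0 : central_one != 0.
Proof.
apply/eqP => /(congr1 (fun u => central_fun u 0%N)) /=.
by apply/eqP; exact: oner_neq0.
Qed.

HB.instance Definition _ := GRing.Zmodule_isNzRing.Build centralSeq
  central_mulA central_mul1l central_mul1r central_mulDl central_mulDr
  central_one_neq0.

Lemma central_scaleA a e (u : centralSeq) :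
  central_scale a (central_scale e u) = central_scale (a * e) u.
Proof. by apply: centralSeq_ext => n /=; rewrite scalerA. Qed.
Lemma central_scale1 : left_id 1 central_scale.
Proof. by move=> u; apply: centralSeq_ext => n /=; rewrite scale1r. Qed.
Lemma central_scaleDr : right_distributive central_scale +%R.
Proof. by move=> a u w; apply: centralSeq_ext => n /=; rewrite scalerDr. Qed.
Lemma central_scaleDl u :
  {morph central_scale^~ u : a e / a + e}.
Proof. by move=> a e; apply: centralSeq_ext => n /=; rewrite scalerDl. Qed.

HB.instance Definition _ := GRing.Zmodule_isLmodule.Build R[i] centralSeq
  central_scaleA central_scale1 central_scaleDr central_scaleDl.

Lemma central_scaleAl (a : R[i]) (u w : centralSeq) :
  a *: (u * w) = (a *: u) * w.
Proof. by apply: centralSeq_ext => n /=; rewrite -scalerAl. Qed.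
Lemma central_scaleAr (a : R[i]) (u w : centralSeq) :
  a *: (u * w) = u * (a *: w).
Proof. by apply: centralSeq_ext => n /=; rewrite -scalerAr. Qed.

HB.instance Definition _ := GRing.Lmodule_isLalgebra.Build R[i] centralSeq
  central_scaleAl.
HB.instance Definition _ := GRing.Lalgebra_isAlgebra.Build R[i] centralSeq
  central_scaleAr.

Lemma central_dagK : involutive central_dag.
Proof. by move=> u; apply: centralSeq_ext => n /=; rewrite dagK. Qed.
Lemma central_dagD : {morph central_dag : u w / u + w}.
Proof. by move=> u w; apply: centralSeq_ext => n /=; rewrite dagD. Qed.
Lemma central_dagZ (a : R[i]) u :
  central_dag (a *: u) = Num.conj a *: central_dag u.
Proof. by apply: centralSeq_ext => n /=; rewrite dagZ. Qed.
Lemma central_dagM (u w : centralSeq) :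
  central_dag (u * w) = central_dag w * central_dag u.
Proof. by apply: centralSeq_ext => n /=; rewrite dagM. Qed.

Definition centralAlg : starAlg R :=
  StarAlg central_dagK central_dagD central_dagZ central_dagM.

Lemma central_sumE (m : nat) (F : nat -> centralAlg) n :
  central_fun (\sum_(0 <= i < m) F i) n = \sum_(0 <= i < m) central_fun (F i) n.
Proof.
exact: (big_morph (fun u : centralAlg => central_fun u n) (fun _ _ => erefl) erefl).
Qed.

Lemma central_seminorm n :
  cstarSeminorm (fun u : centralAlg => nu (central_fun u n)).
Proof.
split=> [u|u w|u w|a u|u].
- exact: csn_ge0.
- exact: csnD.
- exact: csnM.
- exact: csnZ.
- exact: csnC.
Qed.

Section Endo.
Context (a : starEndo S).
Hypothesis na : forall x, nu (a x) <= nu x.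
Hypothesis ta : forall x, test x -> exists2 y, test y & a y = x.

Definition central_endo_fun (u : centralAlg) : centralAlg :=
  CentralSeq (seq_central_endo na ta (central_prop u)).

Program Definition centralEndo : starEndo centralAlg :=
  @StarEndo R centralAlg central_endo_fun _ _ _ _ _.
Next Obligation. by move=> u w; apply: centralSeq_ext => n /=; rewrite endoD. Qed.
Next Obligation. by move=> u w; apply: centralSeq_ext => n /=; rewrite endoM. Qed.
Next Obligation. by move=> e u; apply: centralSeq_ext => n /=; rewrite endoZ. Qed.
Next Obligation. by apply: centralSeq_ext => n /=; rewrite endo1. Qed.
Next Obligation. by move=> u; apply: centralSeq_ext => n /=; rewrite endo_dag. Qed.

End Endo.
End AsymptoticallyCentral.

(** * Stacks that are moved exactly by a perturbed automorphism *)

Section StackData.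
Context {R : realType} (A : cstarAlgType R) (alpha : {lrmorphism A -> A}).
Hypothesis alpha_star : forall x, alpha (star x) = star (alpha x).
Local Notation S := (cstarA A).
Local Notation nu := (@nrm R A).

Definition alphaEndo : starEndo S :=
  @StarEndo R S alpha (@raddfD _ _ alpha) (@rmorphM _ _ alpha)
    (fun c x => linearZ_LR alpha c x) (rmorph1 alpha) alpha_star.

(** A stack together with a unitary v, close to 1, such that Ad v o alpha
    moves the levels exactly. *)
Record straight_stack (N : nat) (r : R) (F : set A) (e : nat -> S) (p q v : S) :
    Prop := StraightStack {
  ss_proj : forall i, (i < N)%N -> isproj (e i);
  ss_orth : forall i j, (i < N)%N -> (j < N)%N -> i != j -> e i * e j = 0;
  ss_p_src : p^† * p = 1 - \sum_(0 <= i < N) e i;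
  ss_p_iso : p * (p^† * p) = p;
  ss_p_range : e 0%N * p = p;
  ss_q_src : q^† * q = e 0%N;
  ss_q_range : q * q^† = e 1%N;
  ss_unitary : isunitary v;
  ss_near : nu (v - 1) <= r;
  ss_step : forall i, (i.+1 < N)%N -> v * alpha (e i) * v^† = e i.+1;
  ss_central : forall x, F x ->
    nu (x * p - p * x) <= r /\ nu (x * q - q * x) <= r }.

Lemma straighten (N : nat) (r : R) (F : set A) (e : nat -> A) (p q : A) :
  (2 <= N)%N -> 0 < r -> r <= 1 ->
  approximate_stack alpha (r / (16 * N)%:R) N e ->
  partial_isometry p -> partial_isometry q ->
  star p * p = 1 - \sum_(0 <= i < N) e i -> cstar_lt (p * star p) (e 0%N) ->
  star q * q = e 0%N -> q * star q = e 1%N ->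
  (forall x y, F x -> y = p \/ y = q ->
    `|commutator x y| < (r / (16 * N)%:R)%:C) ->
  exists v : S, straight_stack N r F e p q v.
Proof.
move=> N2 r0 r1 [eproj eorth estep] pp pq psrc plt qsrc qrange comm.
have hc := nrm_complete A; have hnu := ccn_seminorm hc.
have N0 : (0 < N)%N by exact: ltnW.
have NR : 0 < ((16 * N)%:R : R) by rewrite ltr0n muln_gt0.
set d := r / (16 * N)%:R.
have dr : 8 * (d *+ (2 * N)) = r.
  rewrite -[d *+ _]mulr_natr /d mulrCA -natrM mulnA.
  by rewrite divfK// gt_eqF.
have dler : d <= r.
  rewrite /d ler_pdivrMr// -[leLHS]mulr1 ler_wpM2l ?(ltW r0)//.
  by rewrite ler1n muln_gt0.
have ep i : (i < N)%N -> @isproj R S (e i) by move=> /eproj.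
pose f i : S := e i.+1; pose g i : S := alphaEndo (e i).
have hf : ortho_family N.-1 f.
  split=> [i hi|i j hi hj]; first by have [] := ep i.+1 ltac:(lia).
  case: eqP => [->|ij]; first by have [] := ep j.+1 ltac:(lia).
  by apply: eorth; lia.
have hg : ortho_family N.-1 g.
  split=> [i hi|i j hi hj].
    by rewrite /g /selfadj -endo_dag (ep i _).1//; lia.
  rewrite /g -endoM; case: eqP => [->|ij]; first by rewrite (ep j _).2//; lia.
  have -> : (e i : S) * (e j : S) = 0 by apply: eorth; lia.
  exact: endo0.
have hd i : (i < N.-1)%N -> nu (f i - g i) <= d.
  move=> hi; rewrite (csnBC hnu) ltW// -nrm_lt; apply: estep; lia.
have d8 : d *+ (2 * N.-1) <= 1 / 8.
  have : d *+ (2 * N.-1) <= d *+ (2 * N).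
    rewrite -[d *+ (2 * N.-1)]mulr_natr -[d *+ (2 * N)]mulr_natr.
    by rewrite ler_wpM2l ?divr_ge0 ?(ltW r0)// ler_nat; lia.
  lra.
have [v [hv nv Hv]] := intertwining_unitary hc hf hg hd d8.
have p_iso : (p : S) * ((p : S)^† * p) = p by apply: (partial_iso hc); exact: pp.
exists v; split.
- exact: ep.
- by move=> i j hi hj ij; apply: eorth => //; apply/eqP.
- exact: psrc.
- exact: p_iso.
- case: plt => -[_ _ [x hx]] _.
  have pr : @isproj R S ((p : S) * (p : S)^†).
    split; first by rewrite /selfadj dagM dagK.
    by rewrite mulrA -(mulrA (p : S)) p_iso.
  have h := proj_le hc (ep 0%N N0) pr hx.
  have h' : (e 0%N : S) * (p : S) = (e 0%N : S) * ((p : S) * (p : S)^†) * (p : S).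
    by rewrite -!mulrA p_iso.
  by rewrite h' h -mulrA p_iso.
- exact: qsrc.
- exact: qrange.
- exact: hv.
- apply: le_trans nv _; rewrite -[leRHS]dr ler_wpM2l//.
  rewrite -[d *+ (2 * N.-1)]mulr_natr -[d *+ (2 * N)]mulr_natr.
  by rewrite ler_wpM2l ?divr_ge0 ?(ltW r0)// ler_nat; lia.
- by move=> i hi; apply: Hv; lia.
move=> x Fx; split; apply: le_trans dler; rewrite ltW// -nrm_lt.
  by apply: comm => //; left.
by apply: comm => //; right.
Qed.

End StackData.

(** * Asymptotically central towers *)

Lemma eventually_all_ord (n : nat) (P : nat -> nat -> Prop) :
  (forall j, (j < n)%N -> exists n0, forall m, (n0 <= m)%N -> P j m) ->
  exists n0, forall m, (n0 <= m)%N -> forall j, (j < n)%N -> P j m.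
Proof.
elim: n => [|n ih] h; first by exists 0%N.
have [|n1 h1] := ih; first by move=> j hj; apply: h; exact: ltnW.
have [n2 h2] := h n (leqnn _).
exists (maxn n1 n2) => m; rewrite geq_max => /andP[m1 m2] j.
by rewrite ltnS leq_eqVlt => /predU1P[->|hj]; [exact: h2|exact: h1].
Qed.

Lemma eventually_all_finite (T : Type) (F : set T) (P : T -> nat -> Prop) :
  finite_set F ->
  (forall x, F x -> exists n0, forall m, (n0 <= m)%N -> P x m) ->
  exists n0, forall m, (n0 <= m)%N -> forall x, F x -> P x m.
Proof.
move=> finF h.
have [f hf] : exists f : T -> nat,
    forall x, F x -> forall m, (f x <= m)%N -> P x m.
  have h' x : exists n0, F x -> forall m, (n0 <= m)%N -> P x m.
    have [Fx|nFx] := pselect (F x); last by exists 0%N.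
    by have [n0 hn] := h x Fx; exists n0.
  by have [f hf] := choice h'; exists f.
have : finite_set (f @` F) by exact: finite_image.
move=> /finite_seqP[s hs].
exists (\max_(i <- s) i) => m hm x Fx; apply: hf => //.
apply: leq_trans hm; apply: (@leq_bigmax_seq _ s xpredT id) => //.
by have : [set` s] (f x) by rewrite -hs; exists x.
Qed.

Lemma rate_small (R : realType) (C e : R) : 0 < e ->
  exists n0, forall n, (n0 <= n)%N -> C * @rate R n <= e.
Proof.
move=> e0; pose D := `|C| / e; have D0 : 0 <= D by rewrite divr_ge0// ltW.
exists (Num.bound D) => n hn.
have hb : D < n.+1%:R.
  by apply: lt_le_trans (archi_boundP D0) _; rewrite ler_nat ltnW.
apply: (@le_trans _ _ (`|C| * @rate R n)).
  by rewrite ler_wpM2r ?ler_norm// ltW// rate_gt0.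
rewrite ler_pdivrMr ?ltr0n// mulrC -ler_pdivrMr//.
exact: ltW.
Qed.

Section Rohlin.
Context {R : realType} (A : cstarAlgType R) (alpha : {lrmorphism A -> A}).
Hypothesis alpha_star : forall x, alpha (star x) = star (alpha x).
Local Notation S := (cstarA A).
Local Notation nu := (@nrm R A).
Local Notation aE := (alphaEndo alpha_star).

(** The whole sequence of stacks is one stack in the algebra of asymptotically
    central sequences, where the construction of exact towers is applied once;
    the towers obtained are read off term by term. *)
Lemma towers_of_straight_stacks (N k : nat) (eta : R) (X : set A)
    (e : nat -> nat -> S) (p q v : nat -> S) (W : nat -> set A) :
  (2 <= N)%N ->
  (forall x, X x -> X (star x)) ->
  (forall x, X x -> exists2 y, X y & alpha y = x) ->
  (forall x, X x -> exists n0, forall n, (n0 <= n)%N -> W n x) ->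
  (forall n, straight_stack alpha N (@rate R n) (W n) (e n) (p n) (q n) (v n)) ->
  stack_yields_towers N k eta ->
  exists (w : nat -> S) (g0 g1 : nat -> nat -> S),
  [/\ forall n, isunitary (w n) /\ nu (w n - 1) <= eta + @rate R n,
      forall n, (forall j, (j < k)%N -> isproj (g0 j n) /\
        w n * alpha (g0 j n) * (w n)^† = g0 j.+1 n) /\ g0 k n = g0 0%N n,
      forall n, (forall j, (j < k.+1)%N -> isproj (g1 j n) /\
        w n * alpha (g1 j n) * (w n)^† = g1 j.+1 n) /\ g1 k.+1 n = g1 0%N n,
      forall n, \sum_(0 <= j < k) g0 j n + \sum_(0 <= j < k.+1) g1 j n = 1 &
      forall j x, X x ->
        (exists C, forall n, nu (x * g0 j n - g0 j n * x) <= C * @rate R n) /\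
        (exists C, forall n, nu (x * g1 j n - g1 j n * x) <= C * @rate R n)].
Proof.
move=> N2 Xstar Xalpha XW hss core.
have hc := nrm_complete A; have hnu : @cstarSeminorm R S nu := ccn_seminorm hc.
have N0 : (0 < N)%N by exact: ltnW.
pose c := @CentralContext R S nu hnu X Xstar.
have central (u : nat -> S) : (forall n, nu (u n) <= 1) ->
    (forall n x, W n x -> nu (x * u n - u n * x) <= @rate R n) ->
    @seq_central R c u.
  move=> u1 uc; split; first by exists 1.
  move=> x Xx; have [n0 hn0] := XW x Xx.
  (* The stacks commute with x only from the n0-th one on; for the earlier
     terms the trivial bound 2 |x| is absorbed in the constant. *)
  exists (1 + 2 * nu x * n0.+1%:R) => n; rewrite mulrDl mul1r.
  have nx : 0 <= nu x by exact: (csn_ge0 hnu).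
  have rn : 0 < @rate R n := rate_gt0 n.
  have [nn|nn] := leqP n0 n.
    apply: le_trans (uc n x (hn0 n nn)) _; rewrite lerDl !mulr_ge0//; exact: ltW.
  apply: (@le_trans _ _ (2 * nu x * (n0.+1%:R * @rate R n))); last first.
    by rewrite mulrA lerDr ltW.
  have h1 : 1 <= n0.+1%:R * @rate R n.
    by rewrite ler_pdivlMr ?ltr0n// mul1r ler_nat ltnW.
  apply: (@le_trans _ _ (2 * nu x)); last by rewrite ler_peMr// mulr_ge0.
  apply: le_trans (csnB hnu _ _) _.
  have h2 := csnM hnu x (u n); have h3 := csnM hnu (u n) x.
  have h4 : nu x * nu (u n) <= nu x * 1 by rewrite ler_wpM2l.
  rewrite (mulrC (nu (u n))) in h3; lra.
have piso n : @isproj R S ((p n)^† * p n).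
  split; first by rewrite /selfadj dagM dagK.
  by rewrite -mulrA (ss_p_iso (hss n)).
have nle1 (x : S) : isproj (x^† * x) -> nu x <= 1.
  move=> hx; rewrite -(@ler_pXn2r _ 2) ?nnegrE ?(csn_ge0 hnu)//.
  by rewrite -(csnC hnu) expr1n; exact: csn_proj.
have qproj n : @isproj R S ((q n)^† * q n).
  by rewrite (ss_q_src (hss n)); exact: (ss_proj (hss n)).
pose pB : centralAlg c := CentralSeq (central p (fun n => nle1 _ (piso n))
  (fun n x Wx => (ss_central (hss n) Wx).1)).
pose qB : centralAlg c := CentralSeq (central q (fun n => nle1 _ (qproj n))
  (fun n x Wx => (ss_central (hss n) Wx).2)).
have vnull : @seq_null R c (fun n => v n - 1).
  by exists 1 => n; rewrite mul1r; exact: (ss_near (hss n)).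
pose vB : centralAlg c := CentralSeq (seq_central_near1 vnull).
have hvB : isunitary vB.
  by split; apply: centralSeq_ext => n; [exact: (ss_unitary (hss n)).1
    |exact: (ss_unitary (hss n)).2].
have na x : nu (aE x) <= nu x by exact: (csn_endo hc).
pose bB := Ad hvB (@centralEndo R c aE na Xalpha).
have lev i n : (i < N)%N -> central_fun (level bB qB i) n = e n i.
  elim: i => [|i ih] hi; first exact: (ss_q_src (hss n)).
  rewrite -(ss_step (hss n) hi) -(ih (ltnW hi)).
  by [].
have e0_idem : level bB qB 0 * level bB qB 0 = level bB qB 0.
  apply: centralSeq_ext => n.
  rewrite -[LHS]/(central_fun (level bB qB 0) n * central_fun (level bB qB 0) n).
  by rewrite !lev//; have [_ h] := ss_proj (hss n) N0; exact: h.
have q_range : qB * qB^† = level bB qB 1.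
  apply: centralSeq_ext => n; rewrite lev//; exact: (ss_q_range (hss n)).
have q_src : qB * level bB qB 0 = qB.
  apply: centralSeq_ext => n.
  rewrite -[LHS]/(q n * central_fun (level bB qB 0) n) lev//.
  rewrite -(ss_q_src (hss n)); apply: (partial_iso hc); exact: qproj.
have e_orth i j : (i < N)%N -> (j < N)%N -> i != j ->
    level bB qB i * level bB qB j = 0.
  move=> hi hj ij; apply: centralSeq_ext => n.
  rewrite -[LHS]/(central_fun (level bB qB i) n * central_fun (level bB qB j) n).
  by rewrite !lev//; exact: (ss_orth (hss n)).
have p_src : pB^† * pB = 1 - \sum_(0 <= i < N) level bB qB i.
  apply: centralSeq_ext => n.
  rewrite -[LHS]/((p n)^† * p n) (ss_p_src (hss n)).
  rewrite -[RHS]/(1 - central_fun (\sum_(0 <= i < N) level bB qB i) n).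
  rewrite central_sumE; congr (_ - _).
  by apply: eq_big_nat => i /andP[_ hi]; rewrite lev.
have p_iso : pB * (pB^† * pB) = pB.
  by apply: centralSeq_ext => n; exact: (ss_p_iso (hss n)).
have p_range : level bB qB 0 * pB = pB.
  apply: centralSeq_ext => n.
  rewrite -[LHS]/(central_fun (level bB qB 0) n * p n) lev//.
  exact: (ss_p_range (hss n)).
have [wB [hw [g0 [g1 [near [p0 [c0 s0]] [p1 [c1 s1]] sum1]]]]] :=
  core _ bB qB pB e0_idem q_range q_src e_orth p_src p_iso p_range.
have uw n : @isunitary R S (central_fun wB n * v n).
  apply: unitaryM; last exact: (ss_unitary (hss n)).
  by have [h1 h2] := hw; split; [have := congr1 (fun u => central_fun u n) h1
    |have := congr1 (fun u => central_fun u n) h2].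
have pr (g : centralAlg c) n : isproj g -> @isproj R S (central_fun g n).
  move=> [h1 h2]; split; first exact: (congr1 (fun u => central_fun u n) h1).
  exact: (congr1 (fun u => central_fun u n) h2).
have stepE (g g' : centralAlg c) n : Ad hw bB g = g' ->
    (central_fun wB n * v n) * alpha (central_fun g n) *
    (central_fun wB n * v n)^† = central_fun g' n.
  move=> <-; rewrite -[RHS]/(central_fun wB n *
    (v n * alpha (central_fun g n) * (v n)^†) * (central_fun wB n)^†).
  by rewrite dagM !mulrA.
exists (fun n => central_fun wB n * v n),
  (fun j n => central_fun (g0 j) n), (fun j n => central_fun (g1 j) n).
split.
- move=> n; split; first exact: uw.
  have -> : central_fun wB n * v n - 1 =
      (central_fun wB n - 1) * v n + (v n - 1).
    by rewrite mulrBl mul1r addrA subrK.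
  apply: le_trans (csnD hnu _ _) _; apply: lerD; last exact: (ss_near (hss n)).
  apply: le_trans (csnM hnu _ _) _.
  apply: (@le_trans _ _ (nu (central_fun wB n - 1) * 1)).
    rewrite ler_wpM2l ?(csn_ge0 hnu)//; apply: csn_unitary => //.
    exact: (ss_unitary (hss n)).
  by rewrite mulr1; exact: (near _ (central_seminorm c n)).
- move=> n; split; last by rewrite c0.
  by move=> j hj; split; [apply: pr; exact: p0|apply: stepE; exact: s0].
- move=> n; split; last by rewrite c1.
  by move=> j hj; split; [apply: pr; exact: p1|apply: stepE; exact: s1].
- move=> n; have := congr1 (fun u => central_fun u n) sum1.
  by rewrite /= !central_sumE.
by move=> j x Xx; split; [exact: (central_prop (g0 j)).2|exact: (central_prop (g1 j)).2].
Qed.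

End Rohlin.

(** * The Rohlin property *)

Lemma unitary_conj_close (R : realType) (S : starAlg R) (nu : S -> R) (w x : S) :
  cstarSeminorm nu -> isunitary w -> nu x <= 1 ->
  nu (x - w * x * w^†) <= 2 * nu (w - 1).
Proof.
move=> hnu hw x1.
have -> : x - w * x * w^† = - ((w - 1) * x * w^†) - x * (w - 1)^†.
  rewrite dagB dag1 !mulrBl mulrBr mul1r mulr1 !opprB.
  by rewrite [RHS]addrC addrA subrK.
have ud : nu w^† <= 1 by rewrite (csn_dag hnu) csn_unitary.
apply: le_trans (csnB hnu _ _) _; rewrite (csnN hnu) mulr_natl mulr2n.
have n0 := csn_ge0 hnu.
apply: lerD.
  apply: le_trans (csnM hnu _ _) _; rewrite -[leRHS]mulr1; apply: ler_pM => //.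
  apply: le_trans (csnM hnu _ _) _; rewrite -[leRHS]mulr1; exact: ler_pM.
apply: le_trans (csnM hnu _ _) _; rewrite (csn_dag hnu) -[leRHS]mul1r.
exact: ler_pM.
Qed.

Theorem theorem3p4 (R : realType) (A : cstarAlgType R)
    (alpha : {lrmorphism A -> A}) (halpha : star_automorphism alpha)
    (hstack : forall (F : set A) (m : nat) (eps : R),
      finite_set F -> (2 <= m)%N -> 0 < eps ->
      exists (e : nat -> A) (p q : A),
        approximate_stack alpha eps m e /\
        partial_isometry p /\ partial_isometry q /\
        (star p * p = 1 - \sum_(0 <= i < m) e i /\ cstar_lt (p * star p) (e 0%N)) /\
        (star q * q = e 0%N /\ q * star q = e 1%N) /\
        (forall x y : A, F x -> y = p \/ y = q ->
          `|commutator x y| < eps%:C)) :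
  rohlin_property alpha.
Proof.
move=> k k0; exists 2%N, (fun i => if i == 0%N then k else k.+1); split=> //.
  by move=> i _; case: ifP.
move=> F eps finF eps0.
have [[ainv aK invK] astar] := halpha.
have invstar x : ainv (star x) = star (ainv x).
  by apply: (can_inj aK); rewrite invK astar invK.
have iterstar i x : iter i ainv (star x) = star (iter i ainv x).
  by elim: i => //= i ->.
(* The unitary w n below satisfies |w n - 1| <= 2 eta, which moves a
   projection by at most 4 eta. *)
pose eta : R := eps / 8; have eta0 : 0 < eta by rewrite divr_gt0.
have [N [N2 core]] := exact_towers k0 eta0.
(* Stacks that commute with the first n translates of F and of its adjoints
   under alpha^-1; the union X of these sets is stable under the star and
   under alpha^-1. *)
pose W n : set A := \bigcup_(i in `I_n.+1)
  ((fun x => iter i ainv x) @` F `|` (fun x => iter i ainv (star x)) @` F).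
have finW n : finite_set (W n).
  apply: bigcup_finite; first exact: finite_II.
  by move=> i _; rewrite finite_setU; split; exact: finite_image.
have Wmono n m : (n <= m)%N -> W n `<=` W m.
  by move=> nm x [i /= hi hx]; exists i => //=; exact: leq_trans hi _.
pose X : set A := [set x | exists n, W n x].
have Xstar x : X x -> X (star x).
  move=> [n [i hi [] [y Fy <-]]]; exists n, i => //.
    by right; exists y => //; rewrite iterstar.
  by left; exists y => //; rewrite iterstar /star cstar_starK.
have Xalpha x : X x -> exists2 y, X y & alpha y = x.
  move=> [n [i hi hx]]; exists (ainv x); last exact: invK.
  by exists n.+1, i.+1 => //; case: hx => [[y Fy <-]|[y Fy <-]];
    [left|right]; exists y.
have XW x : X x -> exists n0, forall n, (n0 <= n)%N -> W n x.
  by move=> [n0 hx]; exists n0 => n nn; exact: Wmono hx.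
have FX x : F x -> X x by move=> Fx; exists 0%N, 0%N => //; left; exists x.
have hdata n : exists d : (nat -> A) * A * A * A,
    straight_stack alpha N (@rate R n) (W n) d.1.1.1 d.1.1.2 d.1.2 d.2.
  have r0 := @rate_gt0 R n.
  have r1 : @rate R n <= 1 by rewrite invf_le1 ?ltr0n// ler1n.
  have e0 : 0 < @rate R n / (16 * N)%:R.
    by rewrite divr_gt0// ltr0n muln_gt0 /= ltnW.
  have [e [p [q [he [hp [hq [[h1 h2] [[h3 h4] h5]]]]]]]] :=
    hstack (W n) N _ (finW n) N2 e0.
  have [v hv] := straighten astar N2 r0 r1 he hp hq h1 h2 h3 h4 h5.
  by exists (e, p, q, v).
have [d hd] := choice hdata.
have [w [g0 [g1 [hw h0 h1 hsum hcomm]]]] :=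
  towers_of_straight_stacks astar N2 Xstar Xalpha XW hd core.
have hnu := @nrm_seminorm R A.
have small (g : nat -> nat -> cstarA A) m :
    (forall j x, X x -> exists C, forall n,
       nrm (x * g j n - g j n * x) <= C * @rate R n) ->
    exists n0, forall n, (n0 <= n)%N -> forall j, (j < m)%N -> forall x, F x ->
      nrm (x * g j n - g j n * x) <= eta.
  move=> hg; apply: eventually_all_ord => j _; apply: eventually_all_finite => //.
  move=> x /FX /(hg j x)[C hC]; have [n0 hn0] := rate_small C eta0.
  by exists n0 => n nn; exact: le_trans (hC n) (hn0 n nn).
have [n0 c0] := small g0 k (fun j x Xx => (hcomm j x Xx).1).
have [n1 c1] := small g1 k.+1 (fun j x Xx => (hcomm j x Xx).2).
have [n2 hr] := rate_small 1 eta0.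
pose n := maxn n0 (maxn n1 n2).
have nn0 : (n0 <= n)%N by rewrite leq_maxl.
have nn1 : (n1 <= n)%N by rewrite /n maxnCA leq_maxl.
have nn2 : (n2 <= n)%N by rewrite /n (maxnC n1) maxnCA leq_maxl.
have etaeps : eta < eps by rewrite /eta; lra.
have wn : nrm (w n - 1) <= 2 * eta.
  apply: le_trans (hw n).2 _; have := hr n nn2; lra.
have close (x y : cstarA A) : isproj x -> w n * alpha x * (w n)^† = y ->
    `|alpha x - y| < eps%:C.
  move=> hx <-; rewrite nrm_lt.
  have ax : @nrm R A (alpha x) <= 1.
    apply: (csn_proj hnu); case: hx => hx1 hx2; split.
      by rewrite /selfadj -[LHS]/(star (alpha x)) -astar; congr (alpha _).
    by rewrite -[LHS](rmorphM alpha); congr (alpha _).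
  apply: le_lt_trans (unitary_conj_close hnu (hw n).1 ax) _.
  apply: (@le_lt_trans _ _ (2 * (2 * eta))); first by rewrite ler_wpM2l.
  rewrite /eta; lra.
exists (fun i j => if i == 0%N then g0 j n else g1 j n); split.
- move=> [|i] j hi hj /=; first by have [[hp _] _] := ((h0 n).1 j hj, tt).
  by have [[hp _] _] := ((h1 n).1 j hj, tt).
- by rewrite big_nat_recr//= big_nat1 /= -(hsum n).
- have next (h : nat) (g : nat -> nat -> cstarA A) j : (j < h)%N ->
      g h n = g 0%N n -> g (j.+1 %% h)%N n = g j.+1 n.
    move=> jh gh; move: (jh); rewrite leq_eqVlt => /predU1P[->|js].
      by rewrite modnn gh.
    by rewrite modn_small.
  move=> [|i] j hi hj /=.
    have [hp hs] := (h0 n).1 j hj; rewrite (next k g0)//; last exact: (h0 n).2.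
    exact: close.
  have [hp hs] := (h1 n).1 j hj; rewrite (next k.+1 g1)//; last exact: (h1 n).2.
  exact: close.
move=> [|i] j x hi hj Fx /=; rewrite nrm_lt; apply: le_lt_trans etaeps.
  exact: c0.
exact: c1.
Qed.
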